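(* For each $\nu>-1$ the radius of starlikeness $r^\star(g_\nu)$ satisfies $r^\star(g_\nu)<\sqrt[4]{4(\nu+1)_3}$. Moreover, under the same condition $\nu>-1$, $$\sqrt[4]{\frac{16(\nu+1)_3}{5}}<r^\star(g_\nu)<\sqrt[4]{\frac{80(\nu+1)_5}{16\nu^2+189\nu+473}},$$ $$\sqrt[8]{\frac{2^8(\nu+1)_3(\nu+1)_5}{16\nu^2+189\nu+473}}<r^\star(g_\nu)<\sqrt[4]{\frac{8(\nu+1)_3(\nu+6)(\nu+7)(16\nu^2+189\nu+473)}{\nu_3}}$$ and $$\sqrt[12]{\frac{2^{11}((\nu+1)_3)^2(\nu+1)_7}{\nu_3}}<r^\star(g_\nu)<\sqrt[4]{\frac{32(\nu+1)_5(\nu+8)(\nu+9)\nu_3}{\nu_4}},$$ where $$\nu_3=32\nu^4+824\nu^3+7969\nu^2+32944\nu+48267$$ and $$\nu_4=256\nu^8+13568\nu^7+312736\nu^6+4085373\nu^5+32951080\nu^4+167370756\nu^3+521177838\nu^2+907600351\nu+675828138.$$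
   Context: For $\nu>-1$, with $J_\nu,I_\nu$ the Bessel and modified Bessel functions of the first kind, $$\mathbf{\Phi}_\nu(z)=J_\nu(z)I_\nu'(z)-J_\nu'(z)I_\nu(z)=2\sum_{n\ge0}\frac{(-1)^n(z/2)^{2\nu+4n+1}}{n!\,\Gamma(\nu+n+1)\Gamma(\nu+2n+2)},$$ $$g_\nu(z)=2^{2\nu}z^{-2\nu}\Gamma(\nu+1)\Gamma(\nu+2)\mathbf{\Phi}_\nu(z)=\sum_{n\ge0}\frac{(-1)^n z^{4n+1}}{2^{4n}n!\,(\nu+1)_n(\nu+2)_{2n}}.$$ The radius of starlikeness is $r^\star(f)=\sup\{r>0:\operatorname{Re}(zf'(z)/f(z))>0\text{ for all }|z|<r\}$. Pochhammer symbol: $(a)_0=1$, $(a)_n=a(a+1)\cdots(a+n-1)$. *)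

(* Defs.v *)
From Stdlib Require Import Reals Factorial.
From Coquelicot Require Import Coquelicot.
Open Scope R_scope.

(* Euler's integral; only meaningful for x > 0. *)
Definition Gamma (x : R) : R :=
  RInt_gen (fun t => Rpower t (x - 1) * exp (- t))
           (at_right 0) (Rbar_locally p_infty).

Fixpoint poch (a : R) (n : nat) : R :=
  match n with
  | O => 1
  | S m => poch a m * (a + INR m)
  end.

(* The Bessel functions carry the branch factor z^nu.  They are taken on the
   half-line x > 0, where the branch is unambiguous; [Rpower] is only meaningful
   for a positive base. *)
Definition bessel_J (nu x : R) : R :=
  Series (fun n => (-1) ^ n / (INR (fact n) * Gamma (nu + INR n + 1))
                   * Rpower (x / 2) (nu + 2 * INR n)).

Definition bessel_I (nu x : R) : R :=
  Series (fun n => 1 / (INR (fact n) * Gamma (nu + INR n + 1))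
                   * Rpower (x / 2) (nu + 2 * INR n)).

Definition Phi (nu x : R) : R :=
  bessel_J nu x * Derive (bessel_I nu) x - Derive (bessel_J nu) x * bessel_I nu x.

Definition entire (f : C -> C) : Prop :=
  exists a : nat -> C, forall z : C,
    is_pseries (K := C_AbsRing) (V := C_NormedModule) a z (f z).

(* The powers of z in z^(-2 nu) Phi_nu(z) cancel, so the normalized function is
   the restriction to x > 0 of an entire function, unique by the identity
   theorem.  That entire function is g_nu. *)
Definition is_g_nu (nu : R) (g : C -> C) : Prop :=
  entire g /\
  forall x : R, 0 < x ->
    g (RtoC x) =
    RtoC (Rpower 2 (2 * nu) * Rpower x (- 2 * nu)
          * Gamma (nu + 1) * Gamma (nu + 2) * Phi nu x).

(* At z = 0 the quotient z f'(z) / f(z) of a function with f(0) = 0 <> f'(0) has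
   a removable singularity with value 1, so the origin imposes no condition.  At
   any other zero of f the quotient has a pole, hence the explicit [f z <> 0].
   [C_derive] agrees with the complex derivative where f is holomorphic, but its
   value is not meaningful elsewhere. *)
Definition starlike_on_disc (f : C -> C) (r : R) : Prop :=
  forall z : C, z <> RtoC 0 -> Cmod z < r ->
    f z <> RtoC 0 /\ 0 < Re (z * C_derive f z / f z)%C.

(* The supremum is taken in the extended reals, so that an inequality
   r_star f < b really bounds the set. *)
Definition r_star (f : C -> C) : Rbar :=
  Lub_Rbar (fun r => 0 < r /\ starlike_on_disc f r).

(* [Rpower y (1 / n)] is the positive n-th root only for y > 0. *)
Definition nth_root (n : nat) (y : R) : R := Rpower y (1 / INR n).

Definition nu_3 (nu : R) : R :=
  32 * nu ^ 4 + 824 * nu ^ 3 + 7969 * nu ^ 2 + 32944 * nu + 48267.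

Definition nu_4 (nu : R) : R :=
  256 * nu ^ 8 + 13568 * nu ^ 7 + 312736 * nu ^ 6 + 4085373 * nu ^ 5
  + 32951080 * nu ^ 4 + 167370756 * nu ^ 3 + 521177838 * nu ^ 2
  + 907600351 * nu + 675828138.

(* Main.v *)
Require Import Defs.
From Stdlib Require Import Reals.
From Coquelicot Require Import Coquelicot.
From Stdlib Require Import Lra Lia Factorial List ClassicalEpsilon.
From mathcomp Require all_boot all_order all_algebra complex Rstruct ring.
Open Scope R_scope.

(** Write c_n for [bessel_product_coef nu n], F(t) for the sum of the c_n t^n and G(t)
    for the sum of the (4n+1) c_n t^n.  Then g_nu(z) = z F(z^4) and g_nu'(z) = G(z^4),
    so z g_nu'(z) / g_nu(z) = 1 + 4 t F'(t) / F(t) at t = z^4.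

    The point is that F and G are limits, coefficient by coefficient, of polynomials
    prod (1 - x t) with all x positive ([laguerre_polya]).  Indeed exp(-t) is the limit
    of (1 - t/m)^m, and p + t p' / b has only positive roots when b > 0 and p has only
    positive roots ([root_coef_euler]).  On coefficients this operator multiplies the
    n-th one by 1 + n/b; composing it for b = a, a+1, ..., a+M-1, rescaling t by 1/M and
    letting M grow divides the n-th coefficient by (a)_n ([laguerre_polya_div_poch]).
    Three such divisions produce F, and b = 1/4 turns F into G.  What
    is needed about zeros is proved for the polynomials and passed to the limit, which is
    uniform on discs because the coefficients are dominated by those of an exponential
    ([root_coef_bound]).

    Let rho be the first positive zero of G.  For a polynomial with positive roots, the
    real part of t p'(t) / p(t) on the circle of radius s, below the first root, is
    smallest at t = s; in the limit this gives Re(z g'/g) >= G(s)/F(s) > 0 for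
    s = |z|^4 < rho ([Re_log_derivative_ge]), while g' vanishes at the fourth root of rho.
    Hence the radius of starlikeness is the fourth root of rho ([r_star_first_zero]).

    The bounds on rho are the Euler-Rayleigh inequalities
    sigma_k^(-1/k) < rho < sigma_k / sigma_(k+1) for k = 1, 2, 3, where sigma_k stands
    for the sum of the k-th powers of the reciprocal zeros of G and is computed from the
    Taylor coefficients by Newton's identities.  The non-strict inequalities are
    positivity statements about power sums.  The strict ones follow from
    sigma_2^2 < sigma_1 sigma_3 and sigma_3^2 < sigma_2 sigma_4, two inequalities
    between explicit polynomials in nu, together with a Cauchy-Schwarz inequality
    for sigma_1, ..., sigma_4 ([euler_rayleigh]).  The bound 4 (nu+1)_3 is weaker than
    sigma_2 / sigma_3.

    It remains to identify the Taylor coefficients of g_nu.  The functional equation of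
    the Gamma integral turns the Bessel series into powers times power series in x^2/4
    with coefficients c_k = 1/(k! (nu+1)_k) up to sign, and k (k + nu) c_k = c_(k-1)
    yields a two-term recurrence for the coefficients of their cross product
    ([cross_coef_step]).  This determines g_nu on the positive half-line, hence
    everywhere ([entire_identity]). *)

(** * Polynomials with positive roots *)

(** Polynomials with positive roots are represented by the list of the reciprocals x of
    their roots, normalized to be 1 at 0: the factor of x is 1 - x t, so that scaling and
    power sums of reciprocal roots become operations on the list. *)
Fixpoint root_coef (xs : list R) (n : nat) : R :=
  match xs, n with
  | nil, O => 1
  | nil, S _ => 0
  | cons x l, O => root_coef l 0
  | cons x l, S m => root_coef l (S m) - x * root_coef l m
  end.

Module RealRooted.
Import all_boot all_order all_algebra complex Rstruct ring.
Import Order.TTheory GRing.Theory Num.Theory.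
Local Open Scope ring_scope.
Local Set Implicit Arguments.
Local Unset Strict Implicit.

Section Euler.
Variable F : rcfType.
Implicit Types (xs : seq F) (b : F).

Definition root_poly (A : comNzRingType) (xs : seq A) : {poly A} :=
  \prod_(x <- xs) (1 - x *: 'X).

Lemma root_polyE (A : comNzRingType) (xs : seq A) (z : A) :
  (root_poly xs).[z] = \prod_(x <- xs) (1 - x * z).
Proof.
by rewrite /root_poly horner_prod; apply: eq_bigr => x _; rewrite !hornerE.
Qed.

(** The logarithmic derivative as a sum over the roots, cleared of its denominator. *)
Lemma horner_Xderiv_root_poly (A : fieldType) (xs : seq A) (z : A) :
  (root_poly xs).[z] != 0 ->
  z * (root_poly xs)^`().[z] =
    - (root_poly xs).[z] * \sum_(x <- xs) (x * z / (1 - x * z)).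
Proof.
rewrite /root_poly; elim: xs => [|x xs IH].
  by rewrite !big_nil -polyC1 derivC !hornerE.
rewrite !big_cons derivM !hornerE mulf_eq0 negb_or => /andP[hx /IH hxs].
rewrite mulrDr (mulrCA z (1 - _)) hxs derivB derivZ derivX -polyC1 derivC.
rewrite !hornerE.
by rewrite /=; field.
Qed.

Definition euler_op b (p : {poly F}) : {poly F} := p + b^-1 *: ('X * p^`()).

(** A root z of p + z p' / b that is not a root of p satisfies
    sum x z / (1 - x z) = b.  The imaginary part of the left side is Im z times a sum of
    positive terms, so z is real, and a real z <= 0 makes every term nonpositive. *)
Lemma euler_op_root xs b (z : F[i]) :
    {in xs, forall x, 0 < x} -> 0 < b ->
    root (map_poly (real_complex F) (euler_op b (root_poly xs))) z ->
  exists2 r : F, 0 < r & z = r%:C%C.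
Proof.
move=> xs_gt0 b_gt0.
set P := map_poly (real_complex F) (root_poly xs).
have PE : P = root_poly [seq x%:C%C | x <- xs].
  rewrite /P /root_poly rmorph_prod big_map; apply: eq_bigr => x _.
  by rewrite rmorphB rmorph1 /= linearZ /= map_polyX.
have -> : map_poly (real_complex F) (euler_op b (root_poly xs)) =
    P + (b^-1)%:C%C *: ('X * P^`()).
  by rewrite /euler_op rmorphD /= linearZ /= rmorphM /= map_polyX deriv_map.
have [/eqP Pz0|Pz0] := boolP (P.[z] == 0).
  move: Pz0; rewrite PE root_polyE => /eqP; rewrite prodf_seq_eq0 /= => /hasP[x'].
  case/mapP => x xin -> /=; have x_gt0 := xs_gt0 x xin.
  rewrite subr_eq0 => /eqP xz1 _; exists x^-1; first by rewrite invr_gt0.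
  have x0 : x%:C%C != 0 :> F[i] by rewrite fmorph_eq0 gt_eqF.
  by rewrite fmorphV /= -[LHS](mulKf x0) -xz1 mulr1.
move=> /rootP; rewrite hornerD hornerZ hornerM hornerX.
rewrite PE horner_Xderiv_root_poly -PE // mulNr mulrN => eq0.
have {eq0} sumE : \sum_(x <- xs) ((1 - x%:C%C * z)^-1 - 1) = b%:C%C.
  have b0 : b%:C%C != 0 :> F[i] by rewrite fmorph_eq0 gt_eqF.
  have := eq0; rewrite fmorphV big_map mulrCA -[X in X - _]mulr1 -mulrBr.
  move=> /eqP; rewrite mulf_eq0 (negbTE Pz0) /= subr_eq0 => /eqP h.
  apply: (mulfI (invr_neq0 b0)); rewrite mulVf // [RHS]h; congr (_ * _).
  apply: eq_big_seq => x xin.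
  have : 1 - x%:C%C * z != 0.
    apply: contra Pz0 => hx; rewrite PE root_polyE prodf_seq_eq0.
    by apply/hasP; exists x%:C%C; rewrite ?map_f.
  by move: (x%:C%C * z) => u hu; field.
case: z Pz0 sumE => zr zi Pz0 sumE.
(* w x is the squared modulus of 1 - x z. *)
pose w x := (1 - x * zr) ^+ 2 + (x * zi) ^+ 2.
have w_ge0 x : 0 <= w x by rewrite addr_ge0 ?sqr_ge0.
have invE x : ((1 - x%:C%C * (zr +i* zi)%C) ^-1 - 1 : F[i]) =
     (((1 - x * zr) / w x - 1) +i* (x * zi / w x))%C :> F[i].
  by simpc; rewrite /w /= sqrrN.
have {}sumE : \sum_(x <- xs) (((1 - x * zr) / w x - 1) +i* (x * zi / w x))%C
    = b%:C%C.
  by rewrite -sumE; apply: eq_bigr => x _; rewrite invE.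
have reE : \sum_(x <- xs) ((1 - x * zr) / w x - 1) = b.
  by rewrite -[RHS]/(complex.Re b%:C%C) -sumE raddf_sum.
have imE : \sum_(x <- xs) (x * zi / w x) = 0.
  by rewrite -[RHS]/(complex.Im b%:C%C) -sumE raddf_sum.
have zr_gt0 : 0 < zr.
  rewrite ltNge; apply/negP => zr_le0.
  suff : b <= 0 by rewrite leNgt b_gt0.
  rewrite -reE big_seq sumr_le0 // => x xin.
  have le1 : 1 <= 1 - x * zr by rewrite lerDl oppr_ge0 pmulr_rle0 ?xs_gt0.
  have w_ge : 1 - x * zr <= w x.
    by rewrite ler_wpDr ?sqr_ge0 // expr2 ler_peMl // (le_trans ler01).
  by rewrite subr_le0 ler_pdivrMr ?mul1r // (lt_le_trans ltr01) // (le_trans le1).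
exists zr => //; congr (_ +i* _)%C; apply/eqP; apply: contraT => zi0.
have w_gt0 x : 0 < x -> 0 < w x.
  by move=> x0; rewrite ltr_wpDl ?sqr_ge0 // exprn_even_gt0 // mulf_neq0 // gt_eqF.
case: xs xs_gt0 reE imE {P PE Pz0 sumE} => [|x s] s_gt0 reE imE.
  by move: b_gt0; rewrite -reE big_nil ltxx.
have : 0 < \sum_(y <- x :: s) y / w y.
  rewrite big_cons ltr_pwDl //.
    by rewrite divr_gt0 ?w_gt0 ?s_gt0 ?mem_head.
  rewrite big_seq sumr_ge0 // => y yin.
  by rewrite divr_ge0 // ltW // s_gt0 // in_cons yin orbT.
suff -> : \sum_(y <- x :: s) y / w y = 0 by rewrite ltxx.
apply: (mulfI zi0); rewrite mulr0 -[RHS]imE mulr_sumr.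
by apply: eq_bigr => y _; rewrite mulrCA mulrA.
Qed.

(** The fundamental theorem of algebra splits the polynomial over the complex numbers, and
    all the roots found there are real and positive, whatever their multiplicities. *)
Lemma euler_op_root_poly xs b :
    {in xs, forall x, 0 < x} -> 0 < b ->
  exists2 ys : seq F, {in ys, forall y, 0 < y} &
    root_poly ys = euler_op b (root_poly xs).
Proof.
move=> xs_gt0 b_gt0; set q := euler_op b _.
have q0 : q.[0] = 1.
  rewrite hornerD root_polyE hornerZ hornerM hornerX mul0r mulr0 addr0.
  by rewrite big1 // => x _; rewrite mulr0 subr0.
have [rs qE] := closed_field_poly_normal (map_poly (real_complex F) q).
have lq0 : lead_coef (map_poly (real_complex F) q) != 0.
  rewrite lead_coef_eq0 map_poly_eq0; apply: contraTneq (oner_neq0 F) => q_eq0.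
  by rewrite -q0 q_eq0 horner0 eqxx.
have rs_pos z : z \in rs -> exists2 r : F, 0 < r & z = r%:C%C.
  move=> zin; apply: (euler_op_root xs_gt0 b_gt0); rewrite -/q qE.
  by rewrite rootZ // root_prod_XsubC.
have [ss ss_gt0 rsE] : exists2 ss : seq F, {in ss, forall s, 0 < s} &
    rs = [seq s%:C%C | s <- ss].
  elim: rs rs_pos {qE} => [|z rs IH] rs_pos; first by exists [::].
  have [|ss ss_gt0 ->] := IH; first by move=> y yin; apply: rs_pos; rewrite in_cons yin orbT.
  have [s s_gt0 ->] := rs_pos z (mem_head _ _).
  by exists (s :: ss) => // y; rewrite in_cons => /orP[/eqP ->|/ss_gt0].
have {}qE : q = lead_coef q *: \prod_(s <- ss) ('X - s%:P).
  apply: (map_poly_inj (real_complex F)); rewrite qE lead_coef_map linearZ /=.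
  congr (_ *: _); rewrite rmorph_prod rsE big_map; apply: eq_bigr => s _.
  by rewrite rmorphB /= map_polyX map_polyC.
exists [seq s^-1 | s <- ss].
  by move=> y /mapP[s sin ->]; rewrite invr_gt0 ss_gt0.
have lqE : lead_coef q * \prod_(s <- ss) (- s) = 1.
  have /= := congr1 (horner^~ 0) qE; rewrite q0 hornerZ horner_prod => h.
  rewrite [RHS]h; congr (_ * _).
  by apply: eq_bigr => s _; rewrite !hornerE.
rewrite qE -[LHS]scale1r -lqE -scalerA; congr (_ *: _).
rewrite /root_poly big_map -scaler_prod.
rewrite !big_seq; apply: eq_bigr => s sin.
have s0 : s != 0 by rewrite gt_eqF // ss_gt0.
rewrite scalerBr scalerA mulNr mulfV // scaleN1r opprK addrC.
by congr (_ + _); rewrite -mul_polyC mulr1 polyCN.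
Qed.
End Euler.

Lemma coef_root_poly (xs : seq R) n : (root_poly xs)`_n = root_coef xs n.
Proof.
rewrite /root_poly; elim: xs n => [|x xs IH] n.
  by rewrite big_nil coef1; case: n.
rewrite big_cons mulrBl mul1r coefB -scalerAl coefZ coefXM.
case: n => [|n] /=; rewrite !IH ?mulr0 ?subr0 //.
Qed.

Lemma euler_root_coef (xs : seq R) (b : R) :
    {in xs, forall x, 0 < x} -> 0 < b ->
  exists2 ys : seq R, {in ys, forall y, 0 < y} &
    forall n, root_coef ys n = (1 + n%:R / b) * root_coef xs n.
Proof.
move=> xs_gt0 b_gt0; have [ys ys_gt0 ysE] := euler_op_root_poly xs_gt0 b_gt0.
exists ys => // n; rewrite -!coef_root_poly ysE coefD coefZ coefXM coef_deriv.
case: n => [|n] /=; first by rewrite mulr0 addr0 mul0r addr0 mul1r.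
rewrite mulrDl mul1r -[_ *+ n.+1]mulr_natl mulrA.
by congr (_ + _); rewrite [_^-1 * _]mulrC.
Qed.
End RealRooted.

Lemma root_coef_euler (xs : list R) (b : R) :
  List.Forall (Rlt 0) xs -> 0 < b ->
  exists ys, List.Forall (Rlt 0) ys /\
    forall n, root_coef ys n = (1 + INR n / b) * root_coef xs n.
Proof.
intros Hxs Hb.
destruct (@RealRooted.euler_root_coef xs b) as [ys Hys E].
- intros x Hx. apply (ssrbool.introT Rstruct.RltP).
  revert Hx. induction Hxs as [|y l Hy Hl IH]; [easy|].
  rewrite seq.in_cons. intro H. apply Bool.orb_prop in H. destruct H as [H|H].
  + now rewrite (ssrbool.elimT eqtype.eqP H).
  + exact (IH H).
- now apply (ssrbool.introT Rstruct.RltP).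
- exists ys. split.
  + clear E. induction ys as [|y l IH]; constructor.
    * apply (ssrbool.elimT Rstruct.RltP), Hys, seq.mem_head.
    * apply IH. intros z Hz. apply Hys. rewrite seq.in_cons.
      apply Bool.orb_true_intro. now right.
  + intro n. rewrite E, <- Rstruct.INRE, <- Rstruct.RdivE. reflexivity.
Qed.

(** * Limits of polynomials with positive roots *)

(** This is the class of entire functions c_0 + c_1 t + ... that are locally uniform limits
    of polynomials with positive roots only (here with c_0 = 1), expressed through finitely many
    coefficients at a time.  Coefficientwise approximation is all that has to be checked to enter
    the class, and quantifying over N and eps makes closure under pointwise limits immediate. *)
Definition laguerre_polya (c : nat -> R) : Prop :=
  forall (N : nat) (eps : R), 0 < eps ->
  exists xs, List.Forall (Rlt 0) xs /\
    forall n, (n <= N)%nat -> Rabs (root_coef xs n - c n) <= eps.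

Lemma laguerre_polya_ext (c d : nat -> R) :
  (forall n, c n = d n) -> laguerre_polya c -> laguerre_polya d.
Proof.
intros E H N eps He. destruct (H N eps He) as [xs [Hx Hc]].
exists xs. split; [exact Hx|]. intros n Hn. rewrite <- E. now apply Hc.
Qed.

Lemma lim_seq_uniform_head (c : nat -> nat -> R) (d : nat -> R) :
  (forall n, is_lim_seq (fun k => c k n) (d n)) ->
  forall N eps, 0 < eps ->
  exists k, forall n, (n <= N)%nat -> Rabs (c k n - d n) < eps.
Proof.
intros H N eps He.
assert (E : eventually (fun k => forall n, (n <= N)%nat -> Rabs (c k n - d n) < eps)).
{ induction N as [|N IH].
  - generalize (proj2 (is_lim_seq_spec _ _) (H 0%nat) (mkposreal eps He)).
    apply filter_imp. intros k Hk n Hn. replace n with 0%nat by lia. exact Hk.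
  - generalize (filter_and _ _ IH
      (proj2 (is_lim_seq_spec _ _) (H (S N)) (mkposreal eps He))).
    apply filter_imp. intros k [Hk1 Hk2] n Hn.
    destruct (Nat.eq_dec n (S N)) as [->|]; [exact Hk2|apply Hk1; lia]. }
destruct E as [k Hk]. exists k. now apply Hk.
Qed.

Lemma laguerre_polya_lim (c : nat -> nat -> R) (d : nat -> R) :
  (forall k, laguerre_polya (c k)) ->
  (forall n, is_lim_seq (fun k => c k n) (d n)) -> laguerre_polya d.
Proof.
intros Hc Hl N eps He.
destruct (lim_seq_uniform_head c d Hl N (eps / 2)) as [k Hk]; [lra|].
destruct (Hc k N (eps / 2)) as [xs [Hx Hxs]]; [lra|].
exists xs. split; [exact Hx|]. intros n Hn.
specialize (Hk n Hn). specialize (Hxs n Hn).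
replace (root_coef xs n - d n)
  with ((root_coef xs n - c k n) + (c k n - d n)) by ring.
eapply Rle_trans; [apply Rabs_triang|]. lra.
Qed.

Lemma laguerre_polya_euler (c : nat -> R) (b : R) :
  0 < b -> laguerre_polya c -> laguerre_polya (fun n => (1 + INR n / b) * c n).
Proof.
intros Hb H N eps He.
assert (HN : 0 <= INR N / b) by (apply Rdiv_le_0_compat; [apply pos_INR|lra]).
destruct (H N (eps / (1 + INR N / b))) as [xs [Hx Hc]].
{ apply Rdiv_lt_0_compat; lra. }
destruct (root_coef_euler xs b Hx Hb) as [ys [Hy E]].
exists ys. split; [exact Hy|]. intros n Hn. rewrite E, <- Rmult_minus_distr_l, Rabs_mult.
assert (Hn' : 0 <= INR n / b <= INR N / b).
{ split; [apply Rdiv_le_0_compat; [apply pos_INR|lra]|].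
  apply Rmult_le_compat_r; [apply Rlt_le, Rinv_0_lt_compat; lra|now apply le_INR]. }
rewrite (Rabs_pos_eq (1 + INR n / b)) by lra.
remember (1 + INR N / b) as q eqn:Eq.
replace eps with (q * (eps / q)) by (field; lra).
apply Rmult_le_compat; try lra; [apply Rabs_pos|now apply Hc].
Qed.

Lemma root_coef_scale (tau : R) (xs : list R) (n : nat) :
  root_coef (map (Rmult tau) xs) n = tau ^ n * root_coef xs n.
Proof.
revert n. induction xs as [|x l IH]; intros [|n]; simpl; try ring.
- rewrite IH. simpl. ring.
- rewrite !IH. simpl. ring.
Qed.

Lemma laguerre_polya_scale (c : nat -> R) (tau : R) :
  0 < tau -> laguerre_polya c -> laguerre_polya (fun n => tau ^ n * c n).
Proof.
intros Ht H N eps He.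
assert (HN : 0 < (1 + tau) ^ N) by (apply pow_lt; lra).
destruct (H N (eps / (1 + tau) ^ N)) as [xs [Hx Hc]].
{ apply Rdiv_lt_0_compat; lra. }
exists (map (Rmult tau) xs). split.
{ apply Forall_map. eapply List.Forall_impl; [|exact Hx]. intros x H0. simpl. nra. }
intros n Hn. rewrite root_coef_scale, <- Rmult_minus_distr_l, Rabs_mult.
assert (Hn0 : 0 < tau ^ n) by (apply pow_lt; lra).
assert (Hn' : tau ^ n <= (1 + tau) ^ N).
{ apply Rle_trans with ((1 + tau) ^ n); [apply pow_incr; lra|apply Rle_pow; [lra|exact Hn]]. }
rewrite (Rabs_pos_eq (tau ^ n)) by lra.
replace eps with ((1 + tau) ^ N * (eps / (1 + tau) ^ N)) by (field; lra).
apply Rmult_le_compat; try lra; [apply Rabs_pos|now apply Hc].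
Qed.

Lemma poch_add (a : R) (m n : nat) :
  poch a (m + n) = poch a m * poch (a + INR m) n.
Proof.
induction n as [|n IH]; simpl.
- rewrite Nat.add_0_r. ring.
- rewrite Nat.add_succ_r. simpl. rewrite IH, plus_INR. ring.
Qed.

Lemma poch_pos (a : R) (n : nat) : 0 < a -> 0 < poch a n.
Proof.
intro Ha. induction n as [|n IH]; simpl; [lra|].
apply Rmult_lt_0_compat; [exact IH|]. generalize (pos_INR n). lra.
Qed.

Lemma poch_double (a : R) (n : nat) :
  poch a (2 * n) = 4 ^ n * poch (a / 2) n * poch ((a + 1) / 2) n.
Proof.
induction n as [|n IH]; [simpl; ring|].
replace (2 * S n)%nat with (S (S (2 * n))) by lia.
cbn [poch]. rewrite IH, S_INR, mult_INR. simpl. field.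
Qed.

Lemma is_lim_seq_inv_S : is_lim_seq (fun m => / INR (S m)) 0.
Proof.
apply (is_lim_seq_incr_1 (fun m => / INR m)).
apply (is_lim_seq_inv _ p_infty); [apply is_lim_seq_INR|easy].
Qed.

(** With s = -1 this gives the coefficients of (1 - t/m)^m, with s = 1 the passage from
    the operators p + t p' / b to the division by a Pochhammer symbol. *)
Lemma poch_asymptotic (a s : R) (n : nat) :
  is_lim_seq (fun m => poch (a + s * INR (S m)) n * (/ INR (S m)) ^ n) (s ^ n).
Proof.
induction n as [|n IH].
- apply is_lim_seq_ext with (fun _ => 1); [intro m; simpl; ring|].
  apply is_lim_seq_const.
- replace (s ^ S n) with (s ^ n * (s + (a + INR n) * 0)) by (simpl; ring).
  apply is_lim_seq_ext with
    (fun m => (poch (a + s * INR (S m)) n * (/ INR (S m)) ^ n)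
       * (s + (a + INR n) * / INR (S m))).
  { intro m. cbn [poch pow]. field. apply not_0_INR. lia. }
  apply (is_lim_seq_mult' _ _ (s ^ n)); [exact IH|].
  apply (is_lim_seq_plus' _ _ s); [apply is_lim_seq_const|].
  apply (is_lim_seq_mult' _ _ (a + INR n)); [apply is_lim_seq_const|].
  exact is_lim_seq_inv_S.
Qed.

Lemma poch_shift (a : R) (n : nat) : poch a (S n) = a * poch (a + 1) n.
Proof. change (S n) with (1 + n)%nat. rewrite poch_add. simpl. ring. Qed.

Lemma INR_fact_S (n : nat) : INR (fact (S n)) = (INR n + 1) * INR (fact n).
Proof. rewrite fact_simpl, mult_INR, S_INR. reflexivity. Qed.

(** The binomial coefficient of m and n is written (-1)^n (-m)_n / n!. *)
Lemma root_coef_repeat (x : R) (m n : nat) :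
  root_coef (repeat x m) n = x ^ n * poch (- INR m) n / INR (fact n).
Proof.
revert n. induction m as [|m IH]; intros [|n].
- simpl. field.
- rewrite poch_shift. simpl. rewrite Ropp_0. unfold Rdiv. ring.
- simpl. rewrite IH. simpl. field.
- change (root_coef (repeat x (S m)) (S n))
    with (root_coef (repeat x m) (S n) - x * root_coef (repeat x m) n).
  rewrite !IH, (poch_shift (- INR (S m))), S_INR, INR_fact_S.
  replace (- (INR m + 1) + 1) with (- INR m) by ring. cbn [poch pow].
  field. split; [apply INR_fact_neq_0|]. generalize (pos_INR n). lra.
Qed.

(** exp(-t) is the limit of (1 - t/m)^m. *)
Lemma laguerre_polya_exp : laguerre_polya (fun n => (-1) ^ n / INR (fact n)).
Proof.
apply laguerre_polya_lim
  with (fun m n => root_coef (repeat (/ INR (S m)) (S m)) n).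
- intros m N eps He. exists (repeat (/ INR (S m)) (S m)). split.
  + apply Forall_forall. intros x Hx. apply repeat_spec in Hx. rewrite Hx.
    apply Rinv_0_lt_compat, lt_0_INR. lia.
  + intros n _. rewrite Rminus_diag, Rabs_R0. lra.
- intro n.
  apply is_lim_seq_ext with
    (fun m => poch (0 + -1 * INR (S m)) n * (/ INR (S m)) ^ n * / INR (fact n)).
  { intro m. rewrite root_coef_repeat.
    replace (0 + -1 * INR (S m)) with (- INR (S m)) by ring. unfold Rdiv. ring. }
  apply (is_lim_seq_mult' _ _ ((-1) ^ n)); [apply poch_asymptotic|apply is_lim_seq_const].
Qed.

(** A special case of Laguerre's theorem on multiplier sequences, 1/Gamma being a limit of
    products of real linear factors.  Applying p + t p' / b for b = a, ..., a+M-1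
    multiplies the n-th coefficient by (a+n)_M / (a)_M, which equals (a+M)_n / (a)_n and is
    equivalent to M^n / (a)_n. *)
Lemma laguerre_polya_div_poch (c : nat -> R) (a : R) :
  0 < a -> laguerre_polya c -> laguerre_polya (fun n => c n / poch a n).
Proof.
intros Ha Hc.
assert (H : forall M, laguerre_polya (fun n => poch (a + INR n) M / poch a M * c n)).
{ induction M as [|M IH].
  - revert Hc. apply laguerre_polya_ext. intro n. simpl. field.
  - assert (HM : 0 < a + INR M) by (generalize (pos_INR M); lra).
    generalize (laguerre_polya_euler _ _ HM IH). apply laguerre_polya_ext.
    intro n. simpl. field. split; [lra|]. generalize (poch_pos a M Ha). lra. }
apply laguerre_polya_lim
  with (fun M n => (/ INR (S M)) ^ n * (poch (a + INR n) (S M) / poch a (S M) * c n)).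
- intro M. apply laguerre_polya_scale; [apply Rinv_0_lt_compat, lt_0_INR; lia|apply H].
- intro n.
  apply is_lim_seq_ext with
    (fun M => poch (a + 1 * INR (S M)) n * (/ INR (S M)) ^ n * (c n / poch a n)).
  { intro M.
    assert (E : poch (a + INR n) (S M) * poch a n = poch (a + INR (S M)) n * poch a (S M)).
    { rewrite (Rmult_comm _ (poch a n)), (Rmult_comm _ (poch a (S M))), <- !poch_add.
      now rewrite Nat.add_comm. }
    rewrite Rmult_1_l.
    replace (poch (a + INR n) (S M)) with
      (poch (a + INR (S M)) n * poch a (S M) / poch a n).
    2:{ rewrite <- E. field. generalize (poch_pos a n Ha). lra. }
    field. generalize (poch_pos a n Ha) (poch_pos a (S M) Ha).
    intros. repeat split; lra. }
  replace (Finite (c n / poch a n)) with (Finite (1 ^ n * (c n / poch a n)))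
    by (f_equal; rewrite pow1; ring).
  apply (is_lim_seq_mult' _ _ (1 ^ n)); [apply poch_asymptotic|apply is_lim_seq_const].
Qed.

Definition bessel_product_coef (nu : R) (n : nat) : R :=
  (-1) ^ n / (16 ^ n * INR (fact n) * poch (nu + 1) n * poch (nu + 2) (2 * n)).

(** The duplication formula writes (nu+2)_(2n) as 4^n times a product of two Pochhammer
    symbols, so three divisions and one rescaling lead from exp(-t) to this series. *)
Lemma laguerre_polya_bessel_product (nu : R) :
  -1 < nu -> laguerre_polya (bessel_product_coef nu).
Proof.
intro Hnu.
assert (H : laguerre_polya (fun n => (/ 64) ^ n *
  ((-1) ^ n / INR (fact n) / poch (nu + 1) n / poch ((nu + 2) / 2) n
    / poch ((nu + 2 + 1) / 2) n))).
{ apply laguerre_polya_scale; [lra|].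
  repeat (apply laguerre_polya_div_poch; [lra|]). exact laguerre_polya_exp. }
revert H. apply laguerre_polya_ext. intro n. unfold bessel_product_coef.
rewrite poch_double, pow_inv. replace 64 with (16 * 4) by ring.
rewrite Rpow_mult_distr. field.
repeat split; try (apply Rgt_not_eq, poch_pos; lra); try (apply pow_nonzero; lra).
apply INR_fact_neq_0.
Qed.

(** * Entire power series on the real line *)

Lemma INR_le_pow2 (n : nat) : INR n <= 2 ^ n.
Proof.
induction n as [|n IH]; [simpl; lra|]. rewrite S_INR. simpl.
assert (1 <= 2 ^ n) by (apply pow_R1_Rle; lra). lra.
Qed.

Lemma ex_series_exp (A : R) : ex_series (fun n => A ^ n / INR (fact n)).
Proof.
exists (exp A). apply is_series_ext with (fun n => / INR (fact n) * A ^ n).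
- intro n. unfold Rdiv. apply Rmult_comm.
- apply (proj1 (is_pseries_R (fun n => / INR (fact n)) A (exp A))), is_exp_Reals.
Qed.

(** Absolute convergence at every radius is the form that passes unchanged to termwise derivatives
    and to complex arguments. *)
Definition entire_coef (c : nat -> R) : Prop :=
  forall r, 0 <= r -> ex_series (fun n => Rabs (c n) * r ^ n).

Lemma entire_coef_le (c d : nat -> R) :
  (forall n, Rabs (c n) <= Rabs (d n)) -> entire_coef d -> entire_coef c.
Proof.
intros H Hd r Hr. apply (ex_series_le (V := R_CompleteNormedModule)) with (2 := Hd r Hr).
intro n. change (Rabs (Rabs (c n) * r ^ n) <= Rabs (d n) * r ^ n).
assert (0 <= r ^ n) by now apply pow_le.
rewrite Rabs_mult, Rabs_Rabsolu, (Rabs_pos_eq (r ^ n)) by easy.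
now apply Rmult_le_compat_r.
Qed.

Lemma entire_coef_exp_bound (c : nat -> R) (A : R) : 0 <= A ->
  (forall n, Rabs (c n) <= A ^ n / INR (fact n)) -> entire_coef c.
Proof.
intros HA H. apply entire_coef_le with (fun n => A ^ n / INR (fact n)).
- intro n. apply Rle_trans with (1 := H n). apply Rle_abs.
- intros r Hr. apply ex_series_ext with (2 := ex_series_exp (A * r)).
  intro n. change (@eq R ((A * r) ^ n / INR (fact n)) (Rabs (A ^ n / INR (fact n)) * r ^ n)).
  rewrite Rabs_pos_eq.
  + rewrite Rpow_mult_distr. unfold Rdiv. ring.
  + apply Rdiv_le_0_compat; [now apply pow_le|apply INR_fact_lt_0].
Qed.

Lemma entire_coef_INR (c : nat -> R) :
  entire_coef c -> entire_coef (fun n => INR n * c n).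
Proof.
intros H r Hr.
apply (ex_series_le (V := R_CompleteNormedModule)) with (2 := H (2 * r) ltac:(lra)).
intro n. change (Rabs (Rabs (INR n * c n) * r ^ n) <= Rabs (c n) * (2 * r) ^ n).
assert (0 <= r ^ n) by now apply pow_le.
rewrite Rabs_mult, Rabs_Rabsolu, Rabs_mult, (Rabs_pos_eq (INR n)), (Rabs_pos_eq (r ^ n))
  by (try apply pos_INR; easy).
rewrite Rpow_mult_distr, (Rmult_comm (INR n)), Rmult_assoc.
apply Rmult_le_compat_l; [apply Rabs_pos|].
apply Rmult_le_compat_r; [easy|apply INR_le_pow2].
Qed.

Lemma entire_coef_derive (c : nat -> R) : entire_coef c -> entire_coef (PS_derive c).
Proof.
intros H r Hr.
assert (Hs := entire_coef_INR c H (r + 1) ltac:(lra)).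
apply (ex_series_incr_1 (V := R_NormedModule)) in Hs.
apply (ex_series_le (V := R_CompleteNormedModule)) with (2 := Hs).
intro n. change (Rabs (Rabs (INR (S n) * c (S n)) * r ^ n)
  <= Rabs (INR (S n) * c (S n)) * (r + 1) ^ S n).
assert (0 <= r ^ n) by now apply pow_le.
rewrite Rabs_mult, Rabs_Rabsolu, (Rabs_pos_eq (r ^ n)) by easy.
apply Rmult_le_compat_l; [apply Rabs_pos|].
assert (r ^ n <= (r + 1) ^ n) by (apply pow_incr; lra). simpl. nra.
Qed.

Lemma entire_coef_minus (c d : nat -> R) :
  entire_coef c -> entire_coef d -> entire_coef (fun n => c n - d n).
Proof.
intros Hc Hd r Hr.
apply (ex_series_le (V := R_CompleteNormedModule))
  with (fun n => Rabs (c n) * r ^ n + Rabs (d n) * r ^ n).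
- intro n. change (Rabs (Rabs (c n - d n) * r ^ n) <= Rabs (c n) * r ^ n + Rabs (d n) * r ^ n).
  assert (0 <= r ^ n) by now apply pow_le.
  rewrite Rabs_mult, Rabs_Rabsolu, (Rabs_pos_eq (r ^ n)), <- Rmult_plus_distr_r by easy.
  apply Rmult_le_compat_r; [easy|].
  eapply Rle_trans; [apply Rabs_triang|]. rewrite Rabs_Ropp. lra.
- apply (ex_series_plus (V := R_NormedModule)); [now apply Hc|now apply Hd].
Qed.

Lemma entire_coef_radius (c : nat -> R) : entire_coef c -> CV_radius c = p_infty.
Proof.
intro Hc. unfold CV_radius.
assert (H : forall r, 0 <= r -> Rbar_le r (Lub_Rbar (CV_disk c))).
{ intros r Hr. apply (proj1 (Lub_Rbar_correct (CV_disk c))).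
  unfold CV_disk. apply ex_series_ext with (2 := Hc r Hr).
  intro n. now rewrite Rabs_mult, (Rabs_pos_eq (r ^ n)) by now apply pow_le. }
destruct (Lub_Rbar (CV_disk c)) as [l| |]; [|easy|].
- exfalso. generalize (H (Rabs l + 1)) (Rabs_pos l) (Rle_abs l). simpl. intros K K1 K2.
  generalize (K ltac:(lra)). lra.
- exfalso. exact (H 0 (Rle_refl 0)).
Qed.

Lemma entire_coef_continuity (c : nat -> R) (t : R) :
  entire_coef c -> continuity_pt (PSeries c) t.
Proof. intro H. apply PSeries_continuity. now rewrite entire_coef_radius. Qed.

Lemma entire_coef_pseries (c : nat -> R) (t : R) :
  entire_coef c -> is_pseries c t (PSeries c t).
Proof.
intro Hc. apply is_pseries_R, Series_correct, ex_series_Rabs.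
apply ex_series_ext with (2 := Hc (Rabs t) (Rabs_pos t)).
intro n. now rewrite Rabs_mult, RPow_abs.
Qed.

Lemma entire_coef_ex_pseries (c : nat -> R) (t : R) : entire_coef c -> ex_pseries c t.
Proof. eexists. now apply entire_coef_pseries. Qed.

Lemma PSeries_INR (c : nat -> R) (t : R) :
  PSeries (fun n => INR n * c n) t = t * PSeries (PS_derive c) t.
Proof.
rewrite <- PSeries_incr_1. apply PSeries_ext. intros [|n]; [apply Rmult_0_l|reflexivity].
Qed.

Lemma Series_term_le (u : nat -> R) (k : nat) :
  (forall n, 0 <= u n) -> ex_series u -> u k <= Series u.
Proof.
intros Hu He.
assert (Hl : is_lim_seq (sum_n u) (Series u)) by exact (Series_correct u He).
apply Rle_trans with (sum_n u k).
- destruct k as [|k]; [rewrite sum_O; lra|]. rewrite sum_Sn.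
  assert (0 <= sum_n u k).
  { rewrite sum_n_Reals. apply cond_pos_sum, Hu. }
  unfold plus; simpl. lra.
- apply (is_lim_seq_incr_compare _ _ Hl).
  intro n. rewrite sum_Sn. unfold plus; simpl. generalize (Hu (S n)). lra.
Qed.

(** Used to cut a dominated series into a finite head and a small tail. *)
Lemma Series_tail_small (u : nat -> R) (eps : R) :
  ex_series u -> 0 < eps ->
  exists N, Rabs (Series (fun k => u (S N + k)%nat)) < eps.
Proof.
intros Hu He.
assert (Hl : is_lim_seq (sum_n u) (Series u)) by exact (Series_correct u Hu).
destruct (proj2 (is_lim_seq_spec _ _) Hl (mkposreal eps He)) as [N HN].
exists N. specialize (HN N (Nat.le_refl N)). simpl in HN.
rewrite (Series_incr_n u (S N)) in HN by (lia || easy). simpl pred in HN.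
rewrite sum_n_Reals in HN.
replace (Series (fun k => u (S N + k)%nat))
  with (- (sum_f_R0 u N - (sum_f_R0 u N + Series (fun k => u (S N + k)%nat)))) by ring.
now rewrite Rabs_Ropp.
Qed.

(** * Polynomials with positive roots converge with all their coefficients *)

Fixpoint power_sum (k : nat) (xs : list R) : R :=
  match xs with nil => 0 | x :: l => x ^ k + power_sum k l end.

(** The first two terms of the binomial expansion of the right side. *)
Lemma pow_plus_deriv_le (s x : R) (n : nat) :
  0 <= s -> 0 <= x -> s ^ S n + (INR n + 1) * x * s ^ n <= (s + x) ^ S n.
Proof.
intros Hs Hx. induction n as [|n IH]; [simpl; lra|].
apply Rle_trans with ((s + x) * (s ^ S n + (INR n + 1) * x * s ^ n)).
- rewrite S_INR. simpl.
  assert (0 <= s ^ n) by now apply pow_le. generalize (pos_INR n). intro.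
  assert (0 <= (INR n + 1) * (x * x) * s ^ n)
    by (apply Rmult_le_pos; [apply Rmult_le_pos; nra|assumption]).
  nra.
- change ((s + x) ^ S (S n)) with ((s + x) * (s + x) ^ S n).
  apply Rmult_le_compat_l; lra.
Qed.

Lemma power_sum_pos (k : nat) (xs : list R) :
  List.Forall (Rlt 0) xs -> 0 <= power_sum k xs.
Proof.
induction 1 as [|x l Hx Hl IH]; simpl; [lra|].
assert (0 <= x ^ k) by (apply pow_le; lra). lra.
Qed.

(** The n-th elementary symmetric function of positive numbers of sum S is at most S^n / n!.
    This bound depends on the first coefficient only, so it is uniform along a coefficientwise
    convergent sequence. *)
Lemma root_coef_bound (xs : list R) (n : nat) :
  List.Forall (Rlt 0) xs ->
  Rabs (root_coef xs n) <= power_sum 1 xs ^ n / INR (fact n).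
Proof.
intro H. revert n. induction H as [|x l Hx Hl IH]; intros [|n].
- simpl. rewrite Rabs_R1. lra.
- simpl. rewrite Rabs_R0, Rmult_0_l. unfold Rdiv. rewrite Rmult_0_l. lra.
- simpl. generalize (IH 0%nat). simpl. trivial.
- change (root_coef (x :: l) (S n)) with (root_coef l (S n) - x * root_coef l n).
  change (power_sum 1 (x :: l)) with (x ^ 1 + power_sum 1 l).
  assert (Hp : 0 <= power_sum 1 l) by now apply power_sum_pos.
  generalize (IH n) (IH (S n)). intros I0 I1.
  apply Rle_trans with (Rabs (root_coef l (S n)) + x * Rabs (root_coef l n)).
  { eapply Rle_trans; [apply Rabs_triang|]. rewrite Rabs_Ropp, Rabs_mult.
    rewrite (Rabs_pos_eq x); lra. }
  apply Rle_trans with (power_sum 1 l ^ S n / INR (fact (S n))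
    + x * (power_sum 1 l ^ n / INR (fact n))).
  { apply Rplus_le_compat; [exact I1|]. apply Rmult_le_compat_l; lra. }
  rewrite INR_fact_S.
  assert (Hf : 0 < INR (fact n)) by apply INR_fact_lt_0.
  generalize (pos_INR n); intro Hn.
  replace (power_sum 1 l ^ S n / ((INR n + 1) * INR (fact n))
    + x * (power_sum 1 l ^ n / INR (fact n))) with
    ((power_sum 1 l ^ S n + (INR n + 1) * x * power_sum 1 l ^ n)
      / ((INR n + 1) * INR (fact n))) by (field; lra).
  apply Rmult_le_compat_r; [apply Rlt_le, Rinv_0_lt_compat, Rmult_lt_0_compat; lra|].
  rewrite pow_1, (Rplus_comm x). apply pow_plus_deriv_le; lra.
Qed.

Lemma root_coef_0 (xs : list R) : root_coef xs 0 = 1.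
Proof. induction xs as [|x l IH]; [reflexivity|exact IH]. Qed.

Lemma root_coef_1 (xs : list R) : root_coef xs 1 = - power_sum 1 xs.
Proof.
induction xs as [|x l IH]; simpl in *; [lra|]. rewrite IH, root_coef_0. ring.
Qed.

Lemma laguerre_polya_approx (c : nat -> R) (N : nat) (eps : R) :
  laguerre_polya c -> 0 < eps -> exists xs, List.Forall (Rlt 0) xs /\
    (forall n, (n <= N)%nat -> Rabs (root_coef xs n - c n) <= eps) /\
    forall n, Rabs (root_coef xs n) <= (Rabs (c 1%nat) + 1) ^ n / INR (fact n).
Proof.
intros Hc He. destruct (Hc (S N) (Rmin eps 1)) as [xs [Hx H]].
{ apply Rmin_glb_lt; lra. }
exists xs. split; [exact Hx|]. split.
- intros n Hn. eapply Rle_trans; [apply H; lia|apply Rmin_l].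
- intro n. eapply Rle_trans; [now apply root_coef_bound|].
  apply Rmult_le_compat_r; [apply Rlt_le, Rinv_0_lt_compat, INR_fact_lt_0|].
  apply pow_incr. split; [now apply power_sum_pos|].
  assert (H1 : Rabs (root_coef xs 1 - c 1%nat) <= 1).
  { eapply Rle_trans; [apply H; lia|apply Rmin_r]. }
  rewrite root_coef_1 in H1. revert H1. unfold Rabs. repeat destruct Rcase_abs; lra.
Qed.

Lemma laguerre_polya_bound (c : nat -> R) (n : nat) :
  laguerre_polya c -> Rabs (c n) <= (Rabs (c 1%nat) + 1) ^ n / INR (fact n).
Proof.
intro Hc. apply le_epsilon. intros eps He.
destruct (laguerre_polya_approx c n eps Hc He) as [xs [_ [H1 H2]]].
replace (c n) with (root_coef xs n + - (root_coef xs n - c n)) at 1 by ring.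
eapply Rle_trans; [apply Rabs_triang|]. rewrite Rabs_Ropp.
apply Rplus_le_compat; [apply H2|]. apply H1. lia.
Qed.

Lemma laguerre_polya_entire (c : nat -> R) : laguerre_polya c -> entire_coef c.
Proof.
intro Hc. apply entire_coef_exp_bound with (Rabs (c 1%nat) + 1).
- generalize (Rabs_pos (c 1%nat)). lra.
- intro n. now apply laguerre_polya_bound.
Qed.

Lemma root_coef_entire (xs : list R) :
  List.Forall (Rlt 0) xs -> entire_coef (root_coef xs).
Proof.
intro H. apply entire_coef_exp_bound with (power_sum 1 xs); [now apply power_sum_pos|].
intro n. now apply root_coef_bound.
Qed.

(** Dominated convergence: an exponential majorant controls the tail, and coefficientwise
    approximation the head. *)
Lemma laguerre_polya_approx_series (c : nat -> R) (s eps : R) :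
  laguerre_polya c -> 0 <= s -> 0 < eps -> exists xs, List.Forall (Rlt 0) xs /\
    Series (fun n => Rabs (root_coef xs n - c n) * s ^ n) <= eps.
Proof.
intros Hc Hs He. pose (A := Rabs (c 1%nat) + 1).
assert (HA : 0 <= A) by (unfold A; generalize (Rabs_pos (c 1%nat)); lra).
pose (u := fun n => 2 * ((A * s) ^ n / INR (fact n))).
assert (Hu : ex_series u) by (apply (ex_series_scal (V := R_NormedModule)), ex_series_exp).
destruct (Series_tail_small u (eps / 2) Hu) as [N HN]; [lra|].
assert (HQ : 0 <= sum_f_R0 (fun n => s ^ n) N).
{ apply cond_pos_sum. intro n. now apply pow_le. }
set (Q := sum_f_R0 (fun n => s ^ n) N) in *.
destruct (laguerre_polya_approx c N (eps / 2 / (1 + Q)) Hc) as [xs [Hx [H1 H2]]].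
{ apply Rdiv_lt_0_compat; lra. }
exists xs. split; [exact Hx|].
assert (Hle : forall n, 0 <= Rabs (root_coef xs n - c n) * s ^ n <= u n).
{ intro n. assert (Hsn : 0 <= s ^ n) by now apply pow_le. split.
  - apply Rmult_le_pos; [apply Rabs_pos|easy].
  - unfold u. rewrite Rpow_mult_distr.
    replace (2 * (A ^ n * s ^ n / INR (fact n))) with (2 * (A ^ n / INR (fact n)) * s ^ n)
      by (field; apply INR_fact_neq_0).
    apply Rmult_le_compat_r; [easy|].
    eapply Rle_trans; [apply Rabs_triang|]. rewrite Rabs_Ropp.
    generalize (H2 n) (laguerre_polya_bound c n Hc). fold A. lra. }
assert (Hd : ex_series (fun n => Rabs (root_coef xs n - c n) * s ^ n)).
{ apply entire_coef_minus; [now apply root_coef_entire|now apply laguerre_polya_entire|exact Hs]. }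
rewrite (Series_incr_n _ (S N)) by (lia || easy). simpl pred.
replace eps with (eps / 2 + eps / 2) by field.
apply Rplus_le_compat.
- apply Rle_trans with (sum_f_R0 (fun n => s ^ n * (eps / 2 / (1 + Q))) N).
  + apply sum_Rle. intros n Hn. rewrite Rmult_comm.
    apply Rmult_le_compat_l; [now apply pow_le|now apply H1].
  + rewrite <- scal_sum. change (eps / 2 / (1 + Q) * Q <= eps / 2).
    apply Rle_trans with (eps / 2 / (1 + Q) * (1 + Q)); [|right; field; lra].
    apply Rmult_le_compat_l; [|lra]. apply Rlt_le, Rdiv_lt_0_compat; lra.
- apply Rle_trans with (Series (fun k => u (S N + k)%nat)).
  + apply Series_le; [intro k; apply Hle|]. now apply ex_series_incr_n.
  + eapply Rle_trans; [apply Rle_abs|apply Rlt_le, HN].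
Qed.

(** * Entire power series in the complex plane *)

(** Real and imaginary parts are summed separately so that the sum is a total function
    defined by real series; [is_cpseries_cseries] relates it to complex convergence. *)
Definition cseries (c : nat -> R) (z : C) : C :=
  (Series (fun n => c n * Re (z ^ n)), Series (fun n => c n * Im (z ^ n))).

Notation is_cpseries c z l :=
  (is_pseries (K := C_AbsRing) (V := C_NormedModule) c z l).

Lemma Im_le_Cmod (z : C) : Rabs (Im z) <= Cmod z.
Proof. eapply Rle_trans; [apply Rmax_r|apply (Rmax_Cmod z)]. Qed.

Lemma ex_series_weighted (c w : nat -> R) (r : R) :
  ex_series (fun n => Rabs (c n) * r ^ n) ->
  (forall n, Rabs (w n) <= r ^ n) ->
  ex_series (fun n => Rabs (c n * w n)).
Proof.
intros Hc Hw. apply (ex_series_le (V := R_CompleteNormedModule)) with (2 := Hc).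
intro n. change (Rabs (Rabs (c n * w n)) <= Rabs (c n) * r ^ n).
rewrite Rabs_Rabsolu, Rabs_mult. apply Rmult_le_compat_l; [apply Rabs_pos|apply Hw].
Qed.

Lemma Re_pow_le (z : C) (r : R) (n : nat) : Cmod z <= r -> Rabs (Re (z ^ n)) <= r ^ n.
Proof.
intro H. eapply Rle_trans; [apply re_le_Cmod|]. rewrite Cmod_pow.
apply pow_incr. split; [apply Cmod_ge_0|easy].
Qed.

Lemma Im_pow_le (z : C) (r : R) (n : nat) : Cmod z <= r -> Rabs (Im (z ^ n)) <= r ^ n.
Proof.
intro H. eapply Rle_trans; [apply Im_le_Cmod|]. rewrite Cmod_pow.
apply pow_incr. split; [apply Cmod_ge_0|easy].
Qed.

Lemma Series_weighted_dist (c d w : nat -> R) (r : R) :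
  entire_coef c -> entire_coef d -> 0 <= r ->
  (forall n, Rabs (w n) <= r ^ n) ->
  Rabs (Series (fun n => c n * w n) - Series (fun n => d n * w n))
    <= Series (fun n => Rabs (c n - d n) * r ^ n).
Proof.
intros Hc Hd Hr Hw.
assert (Ec := ex_series_weighted c w r (Hc r Hr) Hw).
assert (Ed := ex_series_weighted d w r (Hd r Hr) Hw).
assert (Em := ex_series_weighted _ w r (entire_coef_minus c d Hc Hd r Hr) Hw).
rewrite <- Series_minus by now apply ex_series_Rabs.
rewrite (Series_ext _ (fun n => (c n - d n) * w n)) by (intro; ring).
eapply Rle_trans; [now apply Series_Rabs|].
apply Series_le; [|now apply entire_coef_minus].
intro n. split; [apply Rabs_pos|]. rewrite Rabs_mult.
apply Rmult_le_compat_l; [apply Rabs_pos|apply Hw].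
Qed.

Lemma sum_n_C (u : nat -> C) (n : nat) :
  sum_n (G := C_NormedModule) u n =
    (sum_n (fun k => Re (u k)) n, sum_n (fun k => Im (u k)) n).
Proof.
induction n as [|n IH].
- rewrite !sum_O. now destruct (u O).
- rewrite !sum_Sn, IH. reflexivity.
Qed.

Lemma is_series_C_components (u : nat -> C) (l : C) :
  is_series (K := C_AbsRing) (V := C_NormedModule) u l <->
  is_series (fun n => Re (u n)) (Re l) /\ is_series (fun n => Im (u n)) (Im l).
Proof.
split.
- intro H. split; unfold is_series in *.
  + apply filterlim_ext with (fun n => fst (sum_n (G := C_NormedModule) u n)).
    { intro n. now rewrite sum_n_C. }
    eapply filterlim_comp; [exact H|].
    apply filterlim_locally. intro eps.
    exists eps. intros y Hy. apply Hy.
  + apply filterlim_ext with (fun n => snd (sum_n (G := C_NormedModule) u n)).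
    { intro n. now rewrite sum_n_C. }
    eapply filterlim_comp; [exact H|].
    apply filterlim_locally. intro eps.
    exists eps. intros y Hy. apply Hy.
- intros [H1 H2].
  apply filterlim_locally. intro eps.
  generalize (proj1 (filterlim_locally _ _) H1 eps) (proj1 (filterlim_locally _ _) H2 eps).
  intros E1 E2. generalize (filter_and _ _ E1 E2). apply filter_imp.
  intros n [K1 K2]. rewrite sum_n_C. now split.
Qed.

Lemma Re_scal_RtoC (z : C) (r : R) : Re (z * RtoC r) = r * Re z.
Proof. destruct z. simpl. ring. Qed.
Lemma Im_scal_RtoC (z : C) (r : R) : Im (z * RtoC r) = r * Im z.
Proof. destruct z. simpl. ring. Qed.

Lemma is_cpseries_components (c : nat -> R) (z l : C) :
  is_cpseries (fun n => RtoC (c n)) z l <->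
  is_series (fun n => c n * Re (z ^ n)) (Re l) /\
  is_series (fun n => c n * Im (z ^ n)) (Im l).
Proof.
unfold is_pseries.
assert (E1 : forall n, Re (scal (pow_n z n) (RtoC (c n) : C_NormedModule)) = c n * Re (z ^ n)).
{ intro n. etransitivity; [|apply Re_scal_RtoC]. reflexivity. }
assert (E2 : forall n, Im (scal (pow_n z n) (RtoC (c n) : C_NormedModule)) = c n * Im (z ^ n)).
{ intro n. etransitivity; [|apply Im_scal_RtoC]. reflexivity. }
split; intro H.
- apply is_series_C_components in H. destruct H as [H1 H2]. split.
  + eapply is_series_ext; [exact E1|exact H1].
  + eapply is_series_ext; [exact E2|exact H2].
- apply is_series_C_components. destruct H as [H1 H2]. split.
  + eapply is_series_ext; [|exact H1]. intro n. symmetry. apply E1.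
  + eapply is_series_ext; [|exact H2]. intro n. symmetry. apply E2.
Qed.

Lemma is_cpseries_cseries (c : nat -> R) (z : C) :
  entire_coef c -> is_cpseries (fun n => RtoC (c n)) z (cseries c z).
Proof.
intro Hc. apply is_cpseries_components.
assert (Hs := Hc (Cmod z) (Cmod_ge_0 z)).
split; apply Series_correct, ex_series_Rabs, (ex_series_weighted c _ _ Hs); intro n.
- apply Re_pow_le, Rle_refl.
- apply Im_pow_le, Rle_refl.
Qed.

Lemma cseries_unique (c : nat -> R) (z l : C) :
  is_cpseries (fun n => RtoC (c n)) z l -> cseries c z = l.
Proof.
intro H. apply is_cpseries_components in H. destruct H as [H1 H2].
unfold cseries. rewrite (is_series_unique _ _ H1), (is_series_unique _ _ H2).
now destruct l.
Qed.

Lemma cseries_RtoC (c : nat -> R) (t : R) : cseries c (RtoC t) = RtoC (PSeries c t).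
Proof.
unfold cseries, PSeries, RtoC at 3. f_equal.
- apply Series_ext. intro n. now rewrite <- RtoC_pow.
- rewrite (Series_ext _ (fun n => 0 * 0)).
  + rewrite Series_scal_l. ring.
  + intro n. rewrite <- RtoC_pow. simpl. ring.
Qed.

Fixpoint cprod (xs : list R) (z : C) : C :=
  match xs with nil => RtoC 1 | x :: l => ((1 - x * z) * cprod l z)%C end.

(** z times the derivative of [cprod], by the product rule. *)
Fixpoint ctheta (xs : list R) (z : C) : C :=
  match xs with
  | nil => RtoC 0
  | x :: l => ((1 - x * z) * ctheta l z - x * z * cprod l z)%C
  end.

(** Multiplication by 1 - x z on the level of power series. *)
Lemma is_cpseries_step (x : R) (a : nat -> C) (b : nat -> C) (z la lb : C) :
  is_cpseries a z la -> is_cpseries b z lb ->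
  is_cpseries (PS_plus a (PS_scal (RtoC (- x)) (PS_incr_1 b))) z (la - x * (z * lb))%C.
Proof.
intros Ha Hb. replace (la - x * (z * lb))%C with (plus la (scal (RtoC (-x)) (scal z lb))).
2:{ change (la + (RtoC (- x)) * (z * lb) = la - x * (z * lb))%C.
    rewrite RtoC_opp. ring. }
apply (is_pseries_plus (K := C_AbsRing) (V := C_NormedModule)); [exact Ha|].
apply (is_pseries_scal (K := C_AbsRing) (V := C_NormedModule)).
{ apply Cmult_comm. }
now apply (is_pseries_incr_1 (K := C_AbsRing) (V := C_NormedModule)).
Qed.

Lemma is_cpseries_const (k : R) (z : C) :
  is_cpseries (fun n => RtoC (match n with O => k | S _ => 0 end)) z (RtoC k).
Proof.
apply filterlim_ext with (fun _ => RtoC k); [|apply filterlim_const].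
intro n. induction n as [|n IH].
- rewrite sum_O. symmetry. apply (scal_one (V := C_NormedModule)).
- rewrite sum_Sn, <- IH. rewrite (scal_zero_r (V := C_NormedModule)).
  symmetry. apply (plus_zero_r (G := C_NormedModule)).
Qed.

Lemma is_cpseries_cprod (xs : list R) (z : C) :
  is_cpseries (fun n => RtoC (root_coef xs n)) z (cprod xs z).
Proof.
induction xs as [|x l IH].
- apply (is_pseries_ext (K := C_AbsRing) (V := C_NormedModule))
    with (2 := is_cpseries_const 1 z). now intros [|n].
- replace (cprod (x :: l) z) with (cprod l z - x * (z * cprod l z))%C by (simpl; ring).
  apply (is_pseries_ext (K := C_AbsRing) (V := C_NormedModule))
    with (2 := is_cpseries_step x _ _ _ _ _ IH IH).
  intros [|n]; unfold PS_plus, PS_scal, PS_incr_1.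
  + rewrite (scal_zero_r (V := C_NormedModule)). apply (plus_zero_r (G := C_NormedModule)).
  + change (root_coef l (S n) + RtoC (- x) * root_coef l n =
      RtoC (root_coef l (S n) - x * root_coef l n))%C.
    rewrite RtoC_minus, RtoC_mult, RtoC_opp. ring.
Qed.

Lemma is_cpseries_ctheta (xs : list R) (z : C) :
  is_cpseries (fun n => RtoC (INR n * root_coef xs n)) z (ctheta xs z).
Proof.
induction xs as [|x l IH].
- apply (is_pseries_ext (K := C_AbsRing) (V := C_NormedModule))
    with (2 := is_cpseries_const 0 z). intros [|n]; simpl; f_equal; ring.
- replace (ctheta (x :: l) z)
    with (ctheta l z - x * (z * (ctheta l z + cprod l z)))%C by (simpl; ring).
  apply (is_pseries_ext (K := C_AbsRing) (V := C_NormedModule))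
    with (2 := is_cpseries_step x _ _ _ _ _ IH
      (is_pseries_plus (K := C_AbsRing) (V := C_NormedModule) _ _ _ _ _
        IH (is_cpseries_cprod l z))).
  intros [|n]; unfold PS_plus, PS_scal, PS_incr_1.
  + rewrite (scal_zero_r (V := C_NormedModule)).
    rewrite (plus_zero_r (G := C_NormedModule)). simpl. apply (f_equal RtoC). ring.
  + change (RtoC (INR (S n) * root_coef l (S n)) +
        RtoC (- x) * (RtoC (INR n * root_coef l n) + root_coef l n) =
      RtoC (INR (S n) * (root_coef l (S n) - x * root_coef l n)))%C.
    rewrite <- RtoC_plus, <- RtoC_mult, <- RtoC_plus, S_INR. f_equal. ring.
Qed.

(** The weighted distance of the coefficient sequences dominates the distance of the
    functions on the disc of radius s, and that of their Euler derivatives z f' on the disc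
    of radius s/2. *)
Definition approximates (c : nat -> R) (s : R) (xs : nat -> list R) : Prop :=
  (forall N, List.Forall (Rlt 0) (xs N)) /\
  is_lim_seq (fun N => Series (fun n => Rabs (root_coef (xs N) n - c n) * s ^ n)) 0.

Lemma laguerre_polya_approximates (c : nat -> R) (s : R) :
  laguerre_polya c -> 0 <= s -> exists xs, approximates c s xs.
Proof.
intros Hc Hs.
assert (H : forall N, exists xs, List.Forall (Rlt 0) xs /\
  Series (fun n => Rabs (root_coef xs n - c n) * s ^ n) <= / INR (S N)).
{ intro N. apply laguerre_polya_approx_series; [easy|easy|].
  apply Rinv_0_lt_compat, lt_0_INR. lia. }
exists (fun N => proj1_sig (constructive_indefinite_description _ (H N))).
split; intros; [|apply is_lim_seq_le_le with (fun _ => 0) (fun N => / INR (S N))].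
- destruct constructive_indefinite_description as [xs Hx]. apply Hx.
- intro N. destruct constructive_indefinite_description as [xs Hx]. simpl proj1_sig.
  split; [|apply Hx].
  replace 0 with (Series (fun _ : nat => 0 * 0)) by (rewrite Series_scal_l; ring).
  apply Series_le.
  + intro n. split; [lra|]. rewrite Rmult_0_l.
    apply Rmult_le_pos; [apply Rabs_pos|now apply pow_le].
  + apply entire_coef_minus; [now apply root_coef_entire|now apply laguerre_polya_entire|easy].
- apply is_lim_seq_const.
- exact is_lim_seq_inv_S.
Qed.

Lemma is_lim_seq_dist (u v : nat -> R) (l : R) :
  (forall n, Rabs (u n - l) <= v n) -> is_lim_seq v 0 -> is_lim_seq u l.
Proof.
intros H Hv. apply is_lim_seq_ext with (fun n => (u n - l) + l); [intro; ring|].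
replace (Finite l) with (Finite (0 + l)) by (f_equal; ring).
apply is_lim_seq_plus'; [|apply is_lim_seq_const].
apply is_lim_seq_abs_0.
apply is_lim_seq_le_le with (fun _ => 0) v; [|apply is_lim_seq_const|exact Hv].
intro n. split; [apply Rabs_pos|apply H].
Qed.

(** * Zeros of the limit and of its approximants *)

Section Approximation.
Context (c : nat -> R) (s : R) (xs : nat -> list R).
Hypotheses (Hc : laguerre_polya c) (Hs : 0 < s) (Hxs : approximates c s xs).

Let dist N := Series (fun n => Rabs (root_coef (xs N) n - c n) * s ^ n).

Lemma ex_series_dist N : ex_series (fun n => Rabs (root_coef (xs N) n - c n) * s ^ n).
Proof.
apply entire_coef_minus; [|now apply laguerre_polya_entire|lra].
apply root_coef_entire, Hxs.
Qed.

Lemma lim_root_coef k : is_lim_seq (fun N => root_coef (xs N) k) (c k).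
Proof.
assert (Hk : 0 < s ^ k) by now apply pow_lt.
apply is_lim_seq_dist with (fun N => dist N * / s ^ k).
- intro N. apply Rmult_le_reg_r with (s ^ k); [easy|].
  rewrite Rmult_assoc, Rinv_l, Rmult_1_r by lra.
  apply (Series_term_le (fun n => Rabs (root_coef (xs N) n - c n) * s ^ n)).
  + intro n. apply Rmult_le_pos; [apply Rabs_pos|apply pow_le; lra].
  + apply ex_series_dist.
- replace (Finite 0) with (Finite (0 * / s ^ k)) by (f_equal; ring).
  apply is_lim_seq_mult'; [apply Hxs|apply is_lim_seq_const].
Qed.

Lemma cprod_cseries_dist N (w : nat -> R) :
  (forall n, Rabs (w n) <= s ^ n) ->
  Rabs (Series (fun n => root_coef (xs N) n * w n) - Series (fun n => c n * w n)) <= dist N.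
Proof.
intro Hw. apply Series_weighted_dist; [|now apply laguerre_polya_entire|lra|easy].
apply root_coef_entire, Hxs.
Qed.

Lemma ctheta_cseries_dist N (w : nat -> R) :
  (forall n, Rabs (w n) <= (s / 2) ^ n) ->
  Rabs (Series (fun n => INR n * root_coef (xs N) n * w n)
    - Series (fun n => INR n * c n * w n)) <= dist N.
Proof.
intro Hw. eapply Rle_trans; [apply Series_weighted_dist with (r := s / 2)|].
- apply entire_coef_INR, root_coef_entire, Hxs.
- now apply entire_coef_INR, laguerre_polya_entire.
- lra.
- exact Hw.
- apply Series_le; [|apply ex_series_dist]. intro n.
  assert (0 <= (s / 2) ^ n) by (apply pow_le; lra).
  split; [apply Rmult_le_pos; [apply Rabs_pos|easy]|].
  rewrite <- Rmult_minus_distr_l, Rabs_mult, (Rabs_pos_eq (INR n)) by apply pos_INR.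
  replace (s ^ n) with (2 ^ n * (s / 2) ^ n).
  2:{ rewrite <- Rpow_mult_distr. f_equal. field. }
  rewrite (Rmult_comm (INR n)), Rmult_assoc.
  apply Rmult_le_compat_l; [apply Rabs_pos|].
  apply Rmult_le_compat_r; [easy|apply INR_le_pow2].
Qed.

Lemma cprod_E l z : cprod l z = cseries (root_coef l) z.
Proof. symmetry. apply cseries_unique, is_cpseries_cprod. Qed.

Lemma ctheta_E l z : ctheta l z = cseries (fun n => INR n * root_coef l n) z.
Proof. symmetry. apply cseries_unique, is_cpseries_ctheta. Qed.

Lemma lim_cprod z : Cmod z <= s ->
  is_lim_seq (fun N => Re (cprod (xs N) z)) (Re (cseries c z)) /\
  is_lim_seq (fun N => Im (cprod (xs N) z)) (Im (cseries c z)).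
Proof.
intro Hz. split; apply is_lim_seq_dist with dist; try apply Hxs;
  intro N; rewrite cprod_E; apply cprod_cseries_dist; intro n.
- now apply Re_pow_le.
- now apply Im_pow_le.
Qed.

Lemma lim_ctheta z : Cmod z <= s / 2 ->
  is_lim_seq (fun N => Re (ctheta (xs N) z)) (Re (cseries (fun n => INR n * c n) z)) /\
  is_lim_seq (fun N => Im (ctheta (xs N) z)) (Im (cseries (fun n => INR n * c n) z)).
Proof.
intro Hz. split; apply is_lim_seq_dist with dist; try apply Hxs;
  intro N; rewrite ctheta_E; apply ctheta_cseries_dist; intro n.
- now apply Re_pow_le.
- now apply Im_pow_le.
Qed.

Lemma cprod_real_root l t : (exists x, In x l /\ x * t = 1) -> cprod l (RtoC t) = RtoC 0.
Proof.
intros [x [Hx E]]. induction l as [|y l IH]; [easy|].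
simpl. destruct Hx as [->|Hx].
- rewrite <- RtoC_mult, E. ring.
- rewrite (IH Hx). ring.
Qed.

(** The limit is bounded below by a positive constant on the compact interval and the
    approximants converge uniformly there, so that their roots eventually lie beyond t. *)
Lemma approximants_zero_free t :
  0 <= t <= s -> (forall u, 0 <= u <= t -> 0 < PSeries c u) ->
  eventually (fun N => forall x, In x (xs N) -> x * t < 1).
Proof.
intros Ht Hpos.
assert (Hr := entire_coef_radius c (laguerre_polya_entire c Hc)).
destruct (continuity_ab_min (PSeries c) 0 t) as [m [Hm Hm']]; [lra| |].
{ intros u Hu. apply PSeries_continuity. now rewrite Hr. }
assert (H0 := Hpos m Hm').
destruct Hxs as [Hx Hl].
generalize (proj2 (is_lim_seq_spec _ _) Hl (mkposreal _ H0)).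
apply filter_imp. intros N HN x Hin. simpl in HN.
apply Rnot_le_lt. intro Hge.
assert (Hx0 : 0 < x) by (apply (proj1 (List.Forall_forall _ _) (Hx N)); exact Hin).
assert (Ht0 : 0 < t) by nra.
assert (Hu : 0 <= / x <= t).
{ split; [apply Rlt_le, Rinv_0_lt_compat; lra|].
  apply Rmult_le_reg_l with x; [easy|]. rewrite Rinv_r; lra. }
assert (Hz : Re (cprod (xs N) (RtoC (/ x))) = 0).
{ rewrite cprod_real_root; [easy|]. exists x. split; [easy|]. apply Rinv_r; lra. }
assert (Hd := cprod_cseries_dist N (fun n => Re (RtoC (/ x) ^ n))).
assert (Hd' : Rabs (0 - PSeries c (/ x)) <= dist N).
{ rewrite <- Hz, cprod_E. change (PSeries c (/ x)) with (Re (RtoC (PSeries c (/ x)))).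
  rewrite <- cseries_RtoC. apply Hd. intro n. apply Re_pow_le.
  rewrite Cmod_R, Rabs_pos_eq; lra. }
specialize (Hm (/ x) Hu).
rewrite Rminus_0_l, Rabs_Ropp, Rabs_pos_eq in Hd' by lra.
rewrite Rminus_0_r in HN. fold (dist N) in HN. generalize (Rle_abs (dist N)). lra.
Qed.
End Approximation.

(** * Euler-Rayleigh inequalities *)

(** Newton's identities: for the coefficients of prod (1 - x t), [newton1], ..., [newton4]
    are the sums of the first to fourth powers of the x ([newton_root_coef]).  For a limit
    of such polynomials they play the role of the Rayleigh sums over the zeros. *)
Definition newton1 (c : nat -> R) : R := - c 1%nat.
Definition newton2 (c : nat -> R) : R := c 1%nat ^ 2 - 2 * c 2%nat.
Definition newton3 (c : nat -> R) : R :=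
  - c 1%nat ^ 3 + 3 * c 1%nat * c 2%nat - 3 * c 3%nat.
Definition newton4 (c : nat -> R) : R :=
  c 1%nat ^ 4 - 4 * c 1%nat ^ 2 * c 2%nat + 2 * c 2%nat ^ 2
  + 4 * c 1%nat * c 3%nat - 4 * c 4%nat.

Lemma newton_root_coef (xs : list R) :
  newton1 (root_coef xs) = power_sum 1 xs /\
  newton2 (root_coef xs) = power_sum 2 xs /\
  newton3 (root_coef xs) = power_sum 3 xs /\
  newton4 (root_coef xs) = power_sum 4 xs.
Proof.
unfold newton1, newton2, newton3, newton4.
induction xs as [|x l [I1 [I2 [I3 I4]]]].
- simpl. repeat split; ring.
- cbn [root_coef power_sum]. rewrite <- I1, <- I2, <- I3, <- I4, root_coef_0.
  repeat split; ring.
Qed.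

Ltac poly_lim H :=
  lazymatch goal with
  | |- is_lim_seq (fun N => _ - _) _ => apply is_lim_seq_minus'; poly_lim H
  | |- is_lim_seq (fun N => _ + _) _ => apply is_lim_seq_plus'; poly_lim H
  | |- is_lim_seq (fun N => _ * _) _ => apply is_lim_seq_mult'; poly_lim H
  | |- is_lim_seq (fun N => - _) (Finite (- ?l)) =>
      apply (is_lim_seq_opp _ (Finite l)); poly_lim H
  | |- is_lim_seq (fun N => IZR _) _ => apply is_lim_seq_const
  | _ => apply H
  end.

Lemma lim_newton (e : nat -> nat -> R) (c : nat -> R) :
  (forall k, is_lim_seq (fun N => e N k) (c k)) ->
  is_lim_seq (fun N => newton1 (e N)) (newton1 c) /\
  is_lim_seq (fun N => newton2 (e N)) (newton2 c) /\
  is_lim_seq (fun N => newton3 (e N)) (newton3 c) /\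
  is_lim_seq (fun N => newton4 (e N)) (newton4 c).
Proof.
intro H. unfold newton1, newton2, newton3, newton4. simpl pow.
repeat split; poly_lim H.
Qed.

(** The numbers x (1 - s x) are nonnegative weights, and m 1, m 2, m 3 are the moments of
    order 0, 1, 2 of the x for these weights; the last inequality is Cauchy-Schwarz. *)
Lemma power_sum_moments (xs : list R) (s : R) :
  List.Forall (Rlt 0) xs -> (forall x, In x xs -> x * s <= 1) ->
  let m k := power_sum k xs - s * power_sum (S k) xs in
  0 <= m 1%nat /\ 0 <= m 3%nat /\ (m 2%nat) ^ 2 <= m 1%nat * m 3%nat.
Proof.
intros Hx Hs. induction Hx as [|x l Hx Hl IH]; [simpl; lra|].
destruct IH as [H1 [H3 H2]].
{ intros y Hy. apply Hs. now right. }
assert (Hw : 0 <= 1 - s * x) by (generalize (Hs x (or_introl eq_refl)); lra).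
cbn [power_sum].
set (m1 := power_sum 1 l - s * power_sum 2 l) in *.
set (m2 := power_sum 2 l - s * power_sum 3 l) in *.
set (m3 := power_sum 3 l - s * power_sum 4 l) in *.

replace (x ^ 1 + power_sum 1 l - s * (x ^ 2 + power_sum 2 l))
  with (m1 + x * (1 - s * x)) by (unfold m1; ring).
replace (x ^ 2 + power_sum 2 l - s * (x ^ 3 + power_sum 3 l))
  with (m2 + x ^ 2 * (1 - s * x)) by (unfold m2; ring).
replace (x ^ 3 + power_sum 3 l - s * (x ^ 4 + power_sum 4 l))
  with (m3 + x ^ 3 * (1 - s * x)) by (unfold m3; ring).
set (w := 1 - s * x) in *.
assert (0 <= x * w) by (apply Rmult_le_pos; lra).
assert (0 <= x ^ 3 * w) by (apply Rmult_le_pos; [apply pow_le|]; lra).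
repeat split; try lra.
(* The quadratic form m1 X^2 - 2 m2 X + m3 is nonnegative by the induction hypothesis. *)
assert (Hq : 2 * m2 * x <= m1 * x ^ 2 + m3).
{ apply Rsqr_incr_0_var.
  - unfold Rsqr. assert (0 <= (m1 * x ^ 2 - m3) ^ 2) by apply pow2_ge_0.
    assert (m2 ^ 2 * x ^ 2 <= m1 * m3 * x ^ 2)
      by (apply Rmult_le_compat_r; [apply pow2_ge_0|easy]).
    replace ((m1 * x ^ 2 + m3) * (m1 * x ^ 2 + m3))
      with ((m1 * x ^ 2 - m3) ^ 2 + 4 * (m1 * m3 * x ^ 2)) by ring.
    replace (2 * m2 * x * (2 * m2 * x)) with (4 * (m2 ^ 2 * x ^ 2)) by ring. lra.
  - assert (0 <= m1 * x ^ 2) by (apply Rmult_le_pos; [easy|apply pow2_ge_0]). lra. }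
assert (x * w * (2 * m2 * x) <= x * w * (m1 * x ^ 2 + m3))
  by (now apply Rmult_le_compat_l).
apply Rle_trans with (m1 * m3 + x * w * (m1 * x ^ 2 + m3) + (x ^ 2 * w) ^ 2).
- replace ((m2 + x ^ 2 * w) ^ 2) with (m2 ^ 2 + x * w * (2 * m2 * x) + (x ^ 2 * w) ^ 2) by ring.
  lra.
- right. ring.
Qed.

Lemma moments_before_zero (c : nat -> R) (s : R) :
  laguerre_polya c -> 0 < s -> (forall u, 0 <= u <= s -> 0 < PSeries c u) ->
  0 <= newton1 c - s * newton2 c /\ 0 <= newton3 c - s * newton4 c /\
  (newton2 c - s * newton3 c) ^ 2
    <= (newton1 c - s * newton2 c) * (newton3 c - s * newton4 c).
Proof.
intros Hc Hs Hpos.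
destruct (laguerre_polya_approximates c s Hc (Rlt_le _ _ Hs)) as [xs Hxs].
destruct (lim_newton (fun N => root_coef (xs N)) c) as [L1 [L2 [L3 L4]]].
{ intro k. now apply lim_root_coef with s. }
assert (E := approximants_zero_free c s xs Hc Hs Hxs s ltac:(lra) Hpos).
assert (L0 := is_lim_seq_const 0).
assert (Ls := is_lim_seq_const s).
assert (D12 := is_lim_seq_minus' _ _ _ _ L1 (is_lim_seq_mult' _ _ _ _ Ls L2)).
assert (D23 := is_lim_seq_minus' _ _ _ _ L2 (is_lim_seq_mult' _ _ _ _ Ls L3)).
assert (D34 := is_lim_seq_minus' _ _ _ _ L3 (is_lim_seq_mult' _ _ _ _ Ls L4)).
assert (M : eventually (fun N => let e := root_coef (xs N) in
  0 <= newton1 e - s * newton2 e /\ 0 <= newton3 e - s * newton4 e /\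
  (newton2 e - s * newton3 e) ^ 2
    <= (newton1 e - s * newton2 e) * (newton3 e - s * newton4 e))).
{ revert E. apply filter_imp. intros N HN e. unfold e.
  destruct (newton_root_coef (xs N)) as [-> [-> [-> ->]]].
  apply power_sum_moments; [apply Hxs|]. intros x Hx. apply Rlt_le. now apply HN. }
repeat split.
- refine (is_lim_seq_le_loc _ _ _ _ _ L0 D12). revert M. apply filter_imp. intros N M. apply M.
- refine (is_lim_seq_le_loc _ _ _ _ _ L0 D34). revert M. apply filter_imp. intros N M. apply M.
- refine (is_lim_seq_le_loc _ _ _ _ _
    (is_lim_seq_mult' _ _ _ _ D23 (is_lim_seq_mult' _ _ _ _ D23 (is_lim_seq_const 1)))
    (is_lim_seq_mult' _ _ _ _ D12 D34)).
  revert M. apply filter_imp. intros N M. apply M.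
Qed.

Fixpoint rprod (xs : list R) (t : R) : R :=
  match xs with nil => 1 | x :: l => (1 - x * t) * rprod l t end.

Lemma cprod_RtoC (xs : list R) (t : R) : cprod xs (RtoC t) = RtoC (rprod xs t).
Proof.
induction xs as [|x l IH]; [reflexivity|].
simpl. rewrite IH. rewrite RtoC_mult, RtoC_minus, RtoC_mult. ring.
Qed.

Lemma lim_rprod (c : nat -> R) (s : R) (xs : nat -> list R) (t : R) :
  laguerre_polya c -> 0 < s -> approximates c s xs -> Rabs t <= s ->
  is_lim_seq (fun N => rprod (xs N) t) (PSeries c t).
Proof.
intros Hc Hs Hxs Ht.
destruct (lim_cprod c s xs Hc Hs Hxs (RtoC t)) as [H _]; [now rewrite Cmod_R|].
rewrite cseries_RtoC in H. revert H. apply is_lim_seq_ext.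
intro N. now rewrite cprod_RtoC.
Qed.

Lemma laguerre_polya_0 (c : nat -> R) : laguerre_polya c -> c 0%nat = 1.
Proof.
intro Hc. destruct (laguerre_polya_approximates c 1 Hc Rle_0_1) as [xs Hxs].
assert (H := lim_root_coef c 1 xs Hc Rlt_0_1 Hxs 0).
assert (H1 : is_lim_seq (fun N => root_coef (xs N) 0) 1).
{ apply is_lim_seq_ext with (fun _ => 1); [|apply is_lim_seq_const].
  intro N. now rewrite root_coef_0. }
apply is_lim_seq_unique in H. apply is_lim_seq_unique in H1.
rewrite H in H1. now injection H1.
Qed.

(** From exp(u) >= 1 + u at u = y / (1 - y). *)
Lemma exp_le_1_minus (k y : R) : 0 < k -> 0 <= y -> k <= 1 - y -> exp (- (y / k)) <= 1 - y.
Proof.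
intros Hk Hy H.
apply Rle_trans with (exp (- (y / (1 - y)))).
- assert (H1 : y / (1 - y) <= y / k).
  { apply Rmult_le_compat_l; [easy|]. apply Rinv_le_contravar; lra. }
  destruct H1 as [H1| ->]; [|lra]. left. apply exp_increasing. lra.
- rewrite exp_Ropp. apply Rmult_le_reg_r with (exp (y / (1 - y))); [apply exp_pos|].
  rewrite Rinv_l by (apply Rgt_not_eq, exp_pos).
  assert (H1 := exp_ineq1_le (y / (1 - y))).
  apply Rle_trans with ((1 - y) * (1 + y / (1 - y))); [right; field; lra|].
  apply Rmult_le_compat_l; lra.
Qed.

(** If no root of the polynomial comes close to t, its value at t is bounded below in terms of the
    sum of the x alone.  This keeps a limit of such polynomials away from 0 at t, in the
    manner of Hurwitz's theorem. *)
Lemma rprod_lower_bound (k t : R) (xs : list R) :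
  0 < k -> 0 <= t -> List.Forall (Rlt 0) xs -> (forall x, In x xs -> k <= 1 - x * t) ->
  exp (- (power_sum 1 xs * t / k)) <= rprod xs t.
Proof.
intros Hk Ht Hx H. induction Hx as [|x l Hx Hl IH].
- simpl. unfold Rdiv. rewrite !Rmult_0_l, Ropp_0, exp_0. lra.
- cbn [power_sum rprod].
  replace (- ((x ^ 1 + power_sum 1 l) * t / k))
    with (- (x * t / k) + - (power_sum 1 l * t / k)) by (field; lra).
  rewrite exp_plus. apply Rmult_le_compat.
  + apply Rlt_le, exp_pos.
  + apply Rlt_le, exp_pos.
  + apply exp_le_1_minus; [easy|apply Rmult_le_pos; lra|apply H; now left].
  + apply IH. intros y Hy. apply H. now right.
Qed.

Lemma pow_le_power_sum (k : nat) (xs : list R) (x : R) :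
  List.Forall (Rlt 0) xs -> In x xs -> x ^ k <= power_sum k xs.
Proof.
intros Hx Hin. induction Hx as [|y l Hy Hl IH]; [easy|]. simpl.
assert (0 <= y ^ k) by (apply pow_le; lra).
assert (0 <= power_sum k l) by now apply power_sum_pos.
destruct Hin as [->|Hin]; [lra|]. specialize (IH Hin). lra.
Qed.

(** Otherwise the fourth power sum of the approximants would force all (x rho)^4 below a
    constant less than 1, and the limit could not vanish at rho.  A zero of the limit thus
    comes from roots of the approximants. *)
Lemma zero_lower_bound (c : nat -> R) (rho : R) :
  laguerre_polya c -> 0 < rho -> PSeries c rho = 0 -> 1 <= newton4 c * rho ^ 4.
Proof.
intros Hc Hr Hz. apply Rnot_lt_le. intro Hlt.
destruct (laguerre_polya_approximates c rho Hc (Rlt_le _ _ Hr)) as [xs Hxs].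
destruct (lim_newton (fun N => root_coef (xs N)) c) as [L1 [_ [_ L4]]].
{ intro k. now apply lim_root_coef with rho. }
assert (Hr4 : 0 < rho ^ 4) by now apply pow_lt.
set (d := 1 - newton4 c * rho ^ 4) in *.
assert (Hd : 0 < d) by (unfold d; lra).
assert (He : 0 < d / 2 / rho ^ 4) by (apply Rdiv_lt_0_compat; lra).
remember (d / 2 / rho ^ 4) as e eqn:Ee.
assert (E4 := proj2 (is_lim_seq_spec _ _) L4 (mkposreal _ He)).
assert (E1 := proj2 (is_lim_seq_spec _ _) L1 (mkposreal 1 Rlt_0_1)).
(* The factor 8 is 2 from passing to the approximants and 4 from 1 - y^4 <= 4 (1 - y). *)
set (k := d / 8). assert (Hk : 0 < k) by (unfold k; lra).
set (m := exp (- ((newton1 c + 1) * rho / k))).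
assert (Hm : 0 < m) by apply exp_pos.
assert (Hle : Rbar_le m (PSeries c rho)).
{ refine (is_lim_seq_le_loc (fun _ => m) (fun N => rprod (xs N) rho) _ _ _
    (is_lim_seq_const m) _).
  2:{ apply lim_rprod with rho; try easy. rewrite Rabs_pos_eq; lra. }
  generalize (filter_and _ _ E1 E4). apply filter_imp. intros N [K1 K4].
  cbn [pos] in K1, K4.
  destruct (newton_root_coef (xs N)) as [R1 [_ [_ R4]]]. rewrite R1 in K1. rewrite R4 in K4.
  destruct Hxs as [Hx _]. specialize (Hx N).
  apply Rle_trans with (exp (- (power_sum 1 (xs N) * rho / k))).
  - assert (H : power_sum 1 (xs N) * rho / k <= (newton1 c + 1) * rho / k).
    { apply Rmult_le_compat_r; [apply Rlt_le, Rinv_0_lt_compat; lra|].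
      apply Rmult_le_compat_r; [lra|]. apply Rabs_def2 in K1. lra. }
    unfold m. destruct H as [H|H]; [left; apply exp_increasing; lra|]. rewrite H. lra.
  - apply rprod_lower_bound; [easy|lra|easy|]. intros x Hin.
    assert (Hx0 : 0 < x) by (apply (proj1 (List.Forall_forall _ _) Hx); exact Hin).
    assert (H4 := pow_le_power_sum 4 (xs N) x Hx Hin).
    apply Rabs_def2 in K4. destruct K4 as [K4 _].
    assert (Hy4 : (x * rho) ^ 4 <= 1 - d / 2).
    { rewrite Rpow_mult_distr.
      apply Rle_trans with ((newton4 c + e) * rho ^ 4).
      - apply Rmult_le_compat_r; lra.
      - right. rewrite Ee. unfold d. field. lra. }
    set (y := x * rho) in *. assert (Hy : 0 < y) by (apply Rmult_lt_0_compat; lra).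
    apply Rnot_lt_le. intro Hyk.
    (* 1 - y^4 <= 4 (1 - y) for y <= 1 *)
    unfold k in Hyk.
    assert (1 - y ^ 4 <= 4 * (1 - y)).
    { assert (0 <= (1 - y) ^ 2 * (3 + 2 * y + y ^ 2))
        by (apply Rmult_le_pos; [apply pow2_ge_0|nra]). nra. }
    lra. }
simpl in Hle. lra.
Qed.

(** As long as the limit stays positive on the interval from 0 to t, [moments_before_zero]
    bounds t by [newton1] / [newton2]; so positivity must end at some finite point. *)
Lemma first_zero (c : nat -> R) :
  laguerre_polya c -> 0 < newton2 c ->
  exists rho, 0 < rho /\ PSeries c rho = 0 /\
    forall u, 0 <= u < rho -> 0 < PSeries c u.
Proof.
intros Hc H2.
pose (E := fun t => 0 <= t /\ forall u, 0 <= u <= t -> 0 < PSeries c u).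
assert (P0 : PSeries c 0 = 1) by (rewrite PSeries_0; now apply laguerre_polya_0).
assert (E0 : E 0).
{ split; [lra|]. intros u Hu. replace u with 0 by lra. lra. }
destruct (completeness E) as [rho [Hub Hlub]].
- exists (Rabs (newton1 c / newton2 c)). intros t [Ht Hp].
  destruct (Req_dec t 0) as [->|Hne]; [apply Rabs_pos|].
  destruct (moments_before_zero c t Hc) as [M _]; [lra|easy|].
  eapply Rle_trans; [|apply Rle_abs].
  apply Rmult_le_reg_r with (newton2 c); [easy|]. unfold Rdiv.
  rewrite Rmult_assoc, Rinv_l by lra. lra.
- now exists 0.
- assert (Hr0 : 0 <= rho) by now apply Hub.
  assert (Hpos : forall u, 0 <= u < rho -> 0 < PSeries c u).
  { intros u Hu. apply Rnot_le_lt. intro Hn.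
    assert (rho <= u); [|lra]. apply Hlub. intros t [Ht Hp].
    apply Rnot_lt_le. intro Hut. specialize (Hp u). lra. }
  assert (Hcont := entire_coef_continuity c rho (laguerre_polya_entire c Hc)).
  assert (Hcl := proj1 (continuity_pt_locally _ _) Hcont).
  assert (Hz : PSeries c rho = 0).
  { destruct (Rtotal_order (PSeries c rho) 0) as [Hn|[Hn|Hn]]; [exfalso|easy|exfalso].
    - assert (Hrne : rho <> 0) by (intro Hr; rewrite Hr in Hn; lra).
      destruct (Hcl (mkposreal (- PSeries c rho) ltac:(lra))) as [d Hd].
      assert (Hd0 := cond_pos d).
      set (u := rho - Rmin (d / 2) rho).
      assert (Hmin : 0 < Rmin (d / 2) rho) by (apply Rmin_glb_lt; lra).
      assert (Hmd := Rmin_l (d / 2) rho). assert (Hmr := Rmin_r (d / 2) rho).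
      assert (Hu : 0 < PSeries c u) by (apply Hpos; unfold u; lra).
      assert (Hb : ball rho d u).
      { change (Rabs (u - rho) < d). unfold u. rewrite Rabs_left; lra. }
      specialize (Hd u Hb). simpl in Hd. apply Rabs_def2 in Hd. lra.
    - destruct (Hcl (mkposreal (PSeries c rho) Hn)) as [d Hd].
      assert (Hd0 := cond_pos d).
      assert (rho + d / 2 <= rho); [|lra]. apply Hub. split; [lra|].
      intros u Hu. destruct (Rlt_or_le u rho) as [Hlt|Hge]; [apply Hpos; lra|].
      assert (Hb : ball rho d u).
      { change (Rabs (u - rho) < d). rewrite Rabs_pos_eq; lra. }
      specialize (Hd u Hb). simpl in Hd. apply Rabs_def2 in Hd. lra. }
  exists rho. repeat split; try easy.
  destruct Hr0 as [Hr0|Hr0]; [easy|]. rewrite <- Hr0 in Hz. lra.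
Qed.

(** The upper bound by sigma_3 / sigma_4 is strict since equality would, by the
    Cauchy-Schwarz inequality, force rho = sigma_2 / sigma_3 as well, which contradicts
    sigma_3^2 < sigma_2 sigma_4.  The other upper bounds are larger by the assumed inequalities.
    The lower bounds descend from 1 <= sigma_4 rho^4 because sigma_(k+1) rho < sigma_k. *)
Theorem euler_rayleigh (c : nat -> R) (rho : R) :
  laguerre_polya c -> 0 < rho -> PSeries c rho = 0 ->
  (forall u, 0 <= u < rho -> 0 < PSeries c u) ->
  0 < newton1 c -> 0 < newton2 c -> 0 < newton3 c -> 0 < newton4 c ->
  newton2 c ^ 2 < newton1 c * newton3 c -> newton3 c ^ 2 < newton2 c * newton4 c ->
  rho < newton1 c / newton2 c /\ rho < newton2 c / newton3 c /\
  rho < newton3 c / newton4 c /\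
  1 < newton1 c * rho /\ 1 < newton2 c * rho ^ 2 /\ 1 < newton3 c * rho ^ 3.
Proof.
intros Hc Hr Hz Hpos P1 P2 P3 P4 H22 H33.
assert (H4 := zero_lower_bound c rho Hc Hr Hz).
assert (M : 0 <= newton1 c - rho * newton2 c /\ 0 <= newton3 c - rho * newton4 c /\
  (newton2 c - rho * newton3 c) ^ 2
    <= (newton1 c - rho * newton2 c) * (newton3 c - rho * newton4 c)).
(* The moment inequalities hold below rho; u approaches rho from the left. *)
{ pose (u := fun N => rho - rho / 2 * / INR (S N)).
  assert (Hu : forall N, 0 < u N < rho).
  { intro N. unfold u. assert (H := lt_0_INR (S N) ltac:(lia)).
    assert (H1 : 1 <= INR (S N)) by (rewrite S_INR; generalize (pos_INR N); lra).
    assert (0 < / INR (S N)) by now apply Rinv_0_lt_compat.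
    assert (/ INR (S N) <= 1) by (rewrite <- Rinv_1; apply Rinv_le_contravar; lra).
    nra. }
  assert (Lu : is_lim_seq u rho).
  { replace (Finite rho) with (Finite (rho - rho / 2 * 0)) by (f_equal; ring).
    apply is_lim_seq_minus'; [apply is_lim_seq_const|].
    apply is_lim_seq_mult'; [apply is_lim_seq_const|exact is_lim_seq_inv_S]. }
  assert (D12 := is_lim_seq_minus' _ _ _ _ (is_lim_seq_const (newton1 c))
    (is_lim_seq_mult' _ _ _ _ Lu (is_lim_seq_const (newton2 c)))).
  assert (D23 := is_lim_seq_minus' _ _ _ _ (is_lim_seq_const (newton2 c))
    (is_lim_seq_mult' _ _ _ _ Lu (is_lim_seq_const (newton3 c)))).
  assert (D34 := is_lim_seq_minus' _ _ _ _ (is_lim_seq_const (newton3 c))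
    (is_lim_seq_mult' _ _ _ _ Lu (is_lim_seq_const (newton4 c)))).
  assert (MU := fun N => moments_before_zero c (u N) Hc (proj1 (Hu N))
    (fun v Hv => Hpos v (conj (proj1 Hv) (Rle_lt_trans _ _ _ (proj2 Hv) (proj2 (Hu N)))))).
  repeat split.
  - refine (is_lim_seq_le _ _ _ _ _ (is_lim_seq_const 0) D12). intro N. apply MU.
  - refine (is_lim_seq_le _ _ _ _ _ (is_lim_seq_const 0) D34). intro N. apply MU.
  - refine (is_lim_seq_le _ _ _ _ _
      (is_lim_seq_mult' _ _ _ _ D23 (is_lim_seq_mult' _ _ _ _ D23 (is_lim_seq_const 1)))
      (is_lim_seq_mult' _ _ _ _ D12 D34)). intro N. apply MU. }
destruct M as [M1 [M3 M2]].
assert (U3 : rho * newton4 c < newton3 c).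
{ apply Rnot_le_lt. intro Hge.
  assert (E3 : newton3 c - rho * newton4 c = 0) by lra. rewrite E3, Rmult_0_r in M2.
  assert (E2 : newton2 c - rho * newton3 c = 0)
    by (generalize (pow2_ge_0 (newton2 c - rho * newton3 c)); nra).
  nra. }
assert (U2 : rho * newton3 c < newton2 c).
{ apply Rmult_lt_reg_r with (newton4 c); [easy|]. nra. }
assert (U1 : rho * newton2 c < newton1 c).
{ apply Rmult_lt_reg_r with (newton3 c); [easy|]. nra. }
assert (L3 : 1 < newton3 c * rho ^ 3).
{ assert (0 < rho ^ 3) by now apply pow_lt.
  replace (newton4 c * rho ^ 4) with (rho * newton4 c * rho ^ 3) in H4 by ring. nra. }
assert (L2 : 1 < newton2 c * rho ^ 2).
{ assert (0 < rho ^ 2) by now apply pow_lt.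
  replace (newton3 c * rho ^ 3) with (rho * newton3 c * rho ^ 2) in L3 by ring. nra. }
assert (L1 : 1 < newton1 c * rho).
{ replace (newton2 c * rho ^ 2) with (rho * newton2 c * rho) in L2 by ring. nra. }
repeat split; try easy.
- now apply Rlt_div_r.
- now apply Rlt_div_r.
- now apply Rlt_div_r.
Qed.

(** * The logarithmic derivative on a circle *)

(** The values of [ctheta] at real arguments. *)
Fixpoint rtheta (xs : list R) (t : R) : R :=
  match xs with
  | nil => 0
  | x :: l => (1 - x * t) * rtheta l t - x * t * rprod l t
  end.

Lemma ctheta_RtoC (xs : list R) (t : R) : ctheta xs (RtoC t) = RtoC (rtheta xs t).
Proof.
induction xs as [|x l IH]; [reflexivity|].
simpl. rewrite IH, cprod_RtoC.
repeat rewrite ?RtoC_mult, ?RtoC_minus. ring.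
Qed.

Lemma Cmod_1_minus (w : C) : 1 - Cmod w <= Cmod (1 - w).
Proof.
assert (H := Cmod_triangle (1 - w) w).
replace (1 - w + w)%C with (RtoC 1) in H by ring. rewrite Cmod_1 in H. lra.
Qed.

(** w / (1 - w) = 1 / (1 - w) - 1 and |1 - w| >= 1 - r. *)
Lemma Re_div_1_minus (w : C) (r : R) :
  Cmod w = r -> r < 1 -> Re (w / (1 - w)) <= r / (1 - r).
Proof.
intros Hw Hr. assert (H1 := Cmod_1_minus w). rewrite Hw in H1.
assert (Hne : (1 - w)%C <> RtoC 0) by (apply Cmod_gt_0; lra).
replace (w / (1 - w))%C with (/ (1 - w) - 1)%C by (field; exact Hne).
replace (r / (1 - r)) with (/ (1 - r) - 1) by (field; lra).
change (Re (/ (1 - w)) - 1 <= / (1 - r) - 1).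
apply Rplus_le_compat_r. eapply Rle_trans; [apply Rle_abs|].
eapply Rle_trans; [apply re_le_Cmod|]. rewrite Cmod_inv by exact Hne.
apply Rinv_le_contravar; lra.
Qed.

(** The logarithmic derivative is minus the sum of the x z / (1 - x z), and each term has its
    largest real part on the circle at the positive real point. *)
Lemma finite_log_derivative (xs : list R) (z : C) :
  List.Forall (Rlt 0) xs -> (forall x, In x xs -> x * Cmod z < 1) ->
  0 < rprod xs (Cmod z) /\ rprod xs (Cmod z) <= Cmod (cprod xs z) /\
  rtheta xs (Cmod z) / rprod xs (Cmod z) <= Re (ctheta xs z / cprod xs z).
Proof.
intros Hx H. induction Hx as [|x l Hx Hl IH].
- simpl. rewrite Cmod_1. repeat split; lra.
- destruct IH as [I0 [I1 I2]]; [intros y Hy; apply H; now right|].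
  specialize (H x (or_introl eq_refl)).
  set (s := Cmod z) in *. assert (Hs : 0 <= s) by apply Cmod_ge_0.
  assert (Hw : Cmod (x * z) = x * s) by (rewrite Cmod_mult, Cmod_R, Rabs_pos_eq; [easy|lra]).
  assert (H1 := Cmod_1_minus (x * z)). rewrite Hw in H1.
  assert (Hc : cprod l z <> RtoC 0) by (apply Cmod_gt_0; lra).
  assert (Hd : (1 - x * z)%C <> RtoC 0) by (apply Cmod_gt_0; lra).
  cbn [rprod cprod rtheta ctheta]. repeat split.
  + apply Rmult_lt_0_compat; lra.
  + rewrite Cmod_mult. apply Rmult_le_compat; lra.
  + replace (((1 - x * s) * rtheta l s - x * s * rprod l s) / ((1 - x * s) * rprod l s))
      with (rtheta l s / rprod l s - x * s / (1 - x * s)) by (field; lra).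
    replace (((1 - x * z) * ctheta l z - x * z * cprod l z) / ((1 - x * z) * cprod l z))%C
      with (ctheta l z / cprod l z - x * z / (1 - x * z))%C by (field; now split).
    change (rtheta l s / rprod l s - x * s / (1 - x * s) <=
      Re (ctheta l z / cprod l z) - Re (x * z / (1 - x * z))).
    assert (H2 := Re_div_1_minus (x * z) (x * s) Hw H). lra.
Qed.

Lemma Re_Cdiv (a b : C) :
  Re (a / b) = (Re a * Re b + Im a * Im b) / (Re b * Re b + Im b * Im b).
Proof.
destruct a as [a1 a2], b as [b1 b2]. unfold Cdiv, Cinv, Cmult, Re, Im; simpl.
unfold Rdiv. rewrite !Rmult_1_r. ring.
Qed.

Lemma Cmod_sqr (a : C) : Cmod a * Cmod a = Re a * Re a + Im a * Im a.
Proof. assert (H := Cmod2_alt a). simpl in H. rewrite !Rmult_1_r in H. exact H. Qed.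

(** The limit of [finite_log_derivative].  The lower bound on the modulus of the
    approximants survives the limit too, which excludes zeros of the limit on the circle. *)
Theorem Re_log_derivative_ge (c : nat -> R) (z : C) :
  laguerre_polya c -> (forall u, 0 <= u <= Cmod z -> 0 < PSeries c u) ->
  cseries c z <> RtoC 0 /\
  PSeries (fun n => INR n * c n) (Cmod z) / PSeries c (Cmod z)
    <= Re (cseries (fun n => INR n * c n) z / cseries c z).
Proof.
intros Hc Hpos. set (s := Cmod z) in *. assert (Hs : 0 <= s) by apply Cmod_ge_0.
(* The Euler derivatives converge on the disc of radius S/2, which must contain z. *)
set (S := 2 * s + 2). assert (HS : 0 < S) by (unfold S; lra).
destruct (laguerre_polya_approximates c S Hc (Rlt_le _ _ HS)) as [xs Hxs].
assert (HsR : Cmod (RtoC s) = s) by (rewrite Cmod_R, Rabs_pos_eq; easy).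
destruct (lim_cprod c S xs Hc HS Hxs z) as [F1 F2]; [unfold S; fold s; lra|].
destruct (lim_ctheta c S xs Hc HS Hxs z) as [T1 T2]; [unfold S; fold s; lra|].
destruct (lim_cprod c S xs Hc HS Hxs (RtoC s)) as [F3 _]; [rewrite HsR; unfold S; lra|].
destruct (lim_ctheta c S xs Hc HS Hxs (RtoC s)) as [T3 _]; [rewrite HsR; unfold S; lra|].
rewrite cseries_RtoC in F3, T3.
assert (Hps : 0 < PSeries c s) by (apply Hpos; lra).
assert (E := approximants_zero_free c S xs Hc HS Hxs s ltac:(unfold S; lra) Hpos).
assert (L : eventually (fun N => 0 < rprod (xs N) s /\ rprod (xs N) s <= Cmod (cprod (xs N) z) /\
  rtheta (xs N) s / rprod (xs N) s <= Re (ctheta (xs N) z / cprod (xs N) z))).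
{ revert E. apply filter_imp. intros N HN. apply finite_log_derivative; [apply Hxs|exact HN]. }
assert (D := is_lim_seq_plus' _ _ _ _ (is_lim_seq_mult' _ _ _ _ F1 F1)
  (is_lim_seq_mult' _ _ _ _ F2 F2)).
assert (Hne : PSeries c s * PSeries c s <= Cmod (cseries c z) * Cmod (cseries c z)).
{ rewrite Cmod_sqr.
  refine (is_lim_seq_le_loc _ _ _ _ _ (is_lim_seq_mult' _ _ _ _ F3 F3) D).
  revert L. apply filter_imp. intros N [L0 [L1 _]].
  rewrite cprod_RtoC, <- Cmod_sqr. simpl Re. apply Rmult_le_compat; lra. }
assert (Hne' : 0 < Cmod (cseries c z) * Cmod (cseries c z)).
{ apply Rlt_le_trans with (2 := Hne). now apply Rmult_lt_0_compat. }
split.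
{ intro H0. rewrite H0, Cmod_0 in Hne'. lra. }
rewrite Re_Cdiv. rewrite Cmod_sqr in Hne'.
refine (is_lim_seq_le_loc _ _ _ _ _
  (is_lim_seq_div' _ _ _ _ T3 F3 (Rgt_not_eq _ _ Hps))
  (is_lim_seq_div' _ _ _ _ (is_lim_seq_plus' _ _ _ _ (is_lim_seq_mult' _ _ _ _ T1 F1)
     (is_lim_seq_mult' _ _ _ _ T2 F2)) D (Rgt_not_eq _ _ Hne'))).
revert L. apply filter_imp. intros N [_ [_ L]].
rewrite ctheta_RtoC, cprod_RtoC, <- Re_Cdiv. exact L.
Qed.

(** * Complex derivative and identity theorem *)

(** The remainder D_n of order two satisfies D_(n+1) = (z + h) D_n + n h^2 z^(n-1), and its real
    counterpart (r+1)^n - r^n - n r^(n-1) satisfies the same recurrence with h = 1. *)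
Lemma pow_taylor_remainder (z h : C) (n : nat) :
  Cmod h <= 1 ->
  Cmod ((z + h) ^ n - z ^ n - INR n * h * z ^ (pred n)) <= Cmod h ^ 2 * (Cmod z + 1) ^ n.
Proof.
intro Hh. set (r := Cmod z). assert (Hr : 0 <= r) by apply Cmod_ge_0.
assert (Hh0 := Cmod_ge_0 h).
assert (H : Cmod ((z + h) ^ n - z ^ n - INR n * h * z ^ (pred n))
  <= Cmod h ^ 2 * ((r + 1) ^ n - r ^ n - INR n * r ^ (pred n))).
{ induction n as [|n IH].
  - simpl. replace (1 - 1 - 0 * h * 1)%C with (RtoC 0) by ring. rewrite Cmod_0. nra.
  - replace ((z + h) ^ S n - z ^ S n - INR (S n) * h * z ^ pred (S n))%C with
      ((z + h) * ((z + h) ^ n - z ^ n - INR n * h * z ^ pred n)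
        + INR n * h ^ 2 * z ^ pred n)%C.
    2:{ rewrite S_INR, RtoC_plus. destruct n as [|n]; simpl; ring. }
    replace ((r + 1) ^ S n - r ^ S n - INR (S n) * r ^ pred (S n)) with
      ((r + 1) * ((r + 1) ^ n - r ^ n - INR n * r ^ pred n) + INR n * r ^ pred n).
    2:{ rewrite S_INR. destruct n as [|n]; simpl; ring. }
    eapply Rle_trans; [apply Cmod_triangle|]. rewrite Rmult_plus_distr_l.
    apply Rplus_le_compat.
    + rewrite Cmod_mult.
      rewrite <- Rmult_assoc, (Rmult_comm (Cmod h ^ 2)), Rmult_assoc.
      apply Rmult_le_compat; [apply Cmod_ge_0|apply Cmod_ge_0| |exact IH].
      eapply Rle_trans; [apply Cmod_triangle|]. fold r. lra.
    + rewrite !Cmod_mult, !Cmod_pow, Cmod_R, Rabs_pos_eq by apply pos_INR. fold r.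
      right. ring. }
eapply Rle_trans; [exact H|]. apply Rmult_le_compat_l; [apply pow2_ge_0|].
assert (0 <= r ^ n) by now apply pow_le.
assert (0 <= INR n * r ^ pred n) by (apply Rmult_le_pos; [apply pos_INR|now apply pow_le]).
lra.
Qed.

(** Summing [pow_taylor_remainder] bounds the first-order Taylor remainder of the series by a
    constant times |h|^2. *)
Lemma is_derive_cseries (c : nat -> R) (z : C) :
  entire_coef c ->
  is_derive (K := C_AbsRing) (V := C_NormedModule) (cseries c) z (cseries (PS_derive c) z).
Proof.
intro Hc. assert (Hc' := entire_coef_derive c Hc).
set (M := Series (fun n => Rabs (c n) * (Cmod z + 1) ^ n)).
assert (HM : ex_series (fun n => Rabs (c n) * (Cmod z + 1) ^ n)).
{ apply Hc. generalize (Cmod_ge_0 z). lra. }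
assert (Hterm : forall n, 0 <= Rabs (c n) * (Cmod z + 1) ^ n).
{ intro n. apply Rmult_le_pos; [apply Rabs_pos|apply pow_le]. generalize (Cmod_ge_0 z). lra. }
assert (HM0 : 0 <= M).
{ apply Rle_trans with (2 := Series_term_le _ 0 Hterm HM). apply Hterm. }
assert (B : forall h, Cmod h <= 1 ->
  Cmod (cseries c (z + h) - cseries c z - h * cseries (PS_derive c) z) <= 2 * M * Cmod h ^ 2).
{ intros h Hh.
  assert (S1 := is_cpseries_cseries c (z + h)%C Hc).
  assert (S2 := is_cpseries_cseries c z Hc).
  assert (S3 := is_cpseries_cseries (PS_derive c) z Hc').
  assert (S4 : is_series (K := C_AbsRing) (V := C_NormedModule)
    (fun n => (RtoC (INR n * c n) * (h * z ^ pred n))%C) (h * cseries (PS_derive c) z)%C).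
  { apply (is_series_decr_1 (K := C_AbsRing) (V := C_NormedModule)).
    replace (plus _ _) with (scal h (cseries (PS_derive c) z)).
    2:{ change (h * cseries (PS_derive c) z = h * cseries (PS_derive c) z +
          - (RtoC (INR 0 * c 0%nat) * (h * 1)))%C. simpl INR. rewrite Rmult_0_l. ring. }
    apply (is_series_ext (K := C_AbsRing) (V := C_NormedModule))
      with (2 := is_series_scal (K := C_AbsRing) (V := C_NormedModule) h _ _ S3).
    intro n. change (h * (z ^ n * RtoC (INR (S n) * c (S n))) =
      RtoC (INR (S n) * c (S n)) * (h * z ^ n))%C. ring. }
  assert (S5 := is_series_minus (K := C_AbsRing) (V := C_NormedModule) _ _ _ _
    (is_series_minus (K := C_AbsRing) (V := C_NormedModule) _ _ _ _ S1 S2) S4).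
  apply is_series_C_components in S5. destruct S5 as [K1 K2].
  set (L := (cseries c (z + h) - cseries c z - h * cseries (PS_derive c) z)%C).
  assert (Hb : forall n, Cmod (RtoC (c n) * ((z + h) ^ n - z ^ n - INR n * h * z ^ pred n))
     <= Cmod h ^ 2 * (Rabs (c n) * (Cmod z + 1) ^ n)).
  { intro n. rewrite Cmod_mult, Cmod_R.
    rewrite <- Rmult_assoc, (Rmult_comm (Cmod h ^ 2)), Rmult_assoc.
    apply Rmult_le_compat_l; [apply Rabs_pos|now apply pow_taylor_remainder]. }
  assert (T : forall u l, is_series u l -> (forall n, Rabs (u n) <=
     Cmod (RtoC (c n) * ((z + h) ^ n - z ^ n - INR n * h * z ^ pred n))) ->
     Rabs l <= Cmod h ^ 2 * M).
  { intros u l Hu Hle. rewrite <- (is_series_unique _ _ Hu).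
    unfold M. rewrite <- Series_scal_l.
    assert (He : ex_series (fun n => Cmod h ^ 2 * (Rabs (c n) * (Cmod z + 1) ^ n)))
      by now apply (ex_series_scal (V := R_NormedModule)).
    assert (Hle' : forall n, Rabs (u n) <= Cmod h ^ 2 * (Rabs (c n) * (Cmod z + 1) ^ n)).
    { intro n. eapply Rle_trans; [apply Hle|apply Hb]. }
    eapply Rle_trans; [apply Series_Rabs|].
    - apply (ex_series_le (V := R_CompleteNormedModule)) with (2 := He).
      intro n. change (Rabs (Rabs (u n)) <= Cmod h ^ 2 * (Rabs (c n) * (Cmod z + 1) ^ n)).
      now rewrite Rabs_Rabsolu.
    - apply Series_le; [|exact He]. intro n. split; [apply Rabs_pos|apply Hle']. }
  assert (EL : L = (RtoC (Re L) + RtoC (Im L) * Ci)%C).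
  { destruct L as [a b]. unfold RtoC, Ci, Cmult, Cplus; simpl. f_equal; ring. }
  assert (Et : forall n,
      minus (minus (scal (pow_n (K := C_AbsRing) (z + h)%C n) (RtoC (c n) : C_NormedModule))
        (scal (pow_n (K := C_AbsRing) z n) (RtoC (c n) : C_NormedModule)))
        (RtoC (INR n * c n) * (h * z ^ pred n))%C =
      (RtoC (c n) * ((z + h) ^ n - z ^ n - INR n * h * z ^ pred n))%C).
  { intro n. change ((z + h) ^ n * c n - z ^ n * c n - RtoC (INR n * c n) * (h * z ^ pred n) =
      RtoC (c n) * ((z + h) ^ n - z ^ n - INR n * h * z ^ pred n))%C.
    rewrite RtoC_mult. ring. }
  rewrite EL. eapply Rle_trans; [apply Cmod_triangle|].
  rewrite Cmod_mult, Cmod_Ci, Rmult_1_r, !Cmod_R.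
  assert (R1 : Rabs (Re L) <= Cmod h ^ 2 * M).
  { apply (T _ _ K1). intro n. eapply Rle_trans; [apply re_le_Cmod|]. right. f_equal. apply Et. }
  assert (R2 : Rabs (Im L) <= Cmod h ^ 2 * M).
  { apply (T _ _ K2). intro n. eapply Rle_trans; [apply Im_le_Cmod|]. right. f_equal. apply Et. }
  lra. }
split.
{ apply (is_linear_scal_l (K := C_AbsRing) (V := C_NormedModule)). }
intros x Hx.
apply (is_filter_lim_locally_unique (K := C_AbsRing)
  (V := AbsRing_NormedModule C_AbsRing)) in Hx.
subst x.
intro eps. assert (He := cond_pos eps).
assert (Hd : 0 < Rmin 1 (eps / (2 * M + 1))).
{ apply Rmin_glb_lt; [lra|]. apply Rdiv_lt_0_compat; lra. }
exists (mkposreal _ Hd). intros y Hy.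
change (Cmod (y - z) < Rmin 1 (eps / (2 * M + 1))) in Hy.
change (Cmod (cseries c y - cseries c z - (y - z) * cseries (PS_derive c) z)
   <= eps * Cmod (y - z)).
assert (H1 := Rmin_l 1 (eps / (2 * M + 1))). assert (H2 := Rmin_r 1 (eps / (2 * M + 1))).
replace (cseries c y) with (cseries c (z + (y - z))%C) by (f_equal; ring).
eapply Rle_trans; [apply B; lra|].
assert (H0 := Cmod_ge_0 (y - z)).
replace (2 * M * Cmod (y - z) ^ 2) with (2 * M * Cmod (y - z) * Cmod (y - z)) by ring.
apply Rmult_le_compat_r; [easy|].
apply Rle_trans with ((2 * M + 1) * (eps / (2 * M + 1))); [|right; field; lra].
apply Rmult_le_compat; lra.
Qed.

Lemma cseries_INR (c : nat -> R) (z : C) : entire_coef c ->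
  cseries (fun n => INR n * c n) z = (z * cseries (PS_derive c) z)%C.
Proof.
intro Hc. apply cseries_unique.
apply (is_pseries_ext (K := C_AbsRing) (V := C_NormedModule)) with
  (2 := is_pseries_incr_1 (K := C_AbsRing) (V := C_NormedModule) _ _ _
    (is_cpseries_cseries _ z (entire_coef_derive c Hc))).
intros [|n]; [simpl; now rewrite Rmult_0_l|reflexivity].
Qed.

(** The chain and product rules live over the absolute ring of complex numbers, the complex
    derivative over its product normed module; both use the same modulus. *)
Lemma is_derive_C_AbsRing (f : C -> C) (z l : C) :
  is_derive (K := C_AbsRing) (V := AbsRing_NormedModule C_AbsRing) f z l <->
  is_derive (K := C_AbsRing) (V := C_NormedModule) f z l.
Proof.
split; intros [_ H]; (split; [|exact H]).
- apply (is_linear_scal_l (K := C_AbsRing) (V := C_NormedModule)).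
- apply (is_linear_scal_l (K := C_AbsRing)).
Qed.

(** The coefficients of a(z^2) when a is a power series. *)
Definition spread {V : AbelianMonoid} (a : nat -> V) (n : nat) : V :=
  if Nat.even n then a (Nat.div2 n) else zero.

Lemma is_pseries_spread (a : nat -> C) (z l : C) :
  is_cpseries a (z * z)%C l -> is_cpseries (spread (V := C_NormedModule) a) z l.
Proof.
intro H.
assert (E : forall n,
  sum_n (fun k => scal (pow_n (K := C_AbsRing) z k) (spread (V := C_NormedModule) a k)) n =
  sum_n (fun k => scal (pow_n (K := C_AbsRing) (z * z)%C k) (a k : C_NormedModule)) (Nat.div2 n)).
{ assert (P : forall n, (pow_n (K := C_AbsRing) z (2 * n) = pow_n (K := C_AbsRing) (z * z)%C n)).
  { intro n. change (z ^ (2 * n) = (z * z) ^ n)%C. rewrite Cpow_mult_r. f_equal. simpl. ring. }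
  assert (Q : forall m,
    sum_n (fun k =>
      scal (pow_n (K := C_AbsRing) z k) (spread (V := C_NormedModule) a k)) (2 * m) =
    sum_n (fun k => scal (pow_n (K := C_AbsRing) (z * z)%C k) (a k : C_NormedModule)) m).
  { induction m as [|m IH].
    - rewrite !sum_O. reflexivity.
    - replace (2 * S m)%nat with (S (S (2 * m))) by lia.
      rewrite !sum_Sn, IH. replace (S (S (2 * m))) with (2 * S m)%nat by lia.
      rewrite P. unfold spread.
      rewrite Nat.even_mul. replace (Nat.even (S (2 * m))) with false.
      + rewrite (scal_zero_r (V := C_NormedModule)), (plus_zero_r (G := C_NormedModule)).
        rewrite Nat.div2_double. reflexivity.
      + rewrite Nat.even_succ, <- Nat.negb_even, Nat.even_mul. reflexivity. }
  intro n. destruct (Nat.Even_or_Odd n) as [[m ->]|[m ->]].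
  - rewrite Nat.div2_double. apply Q.
  - rewrite Nat.add_1_r, Nat.div2_succ_double, sum_Sn, Q. unfold spread at 1.
    replace (Nat.even (S (2 * m))) with false.
    + rewrite (scal_zero_r (V := C_NormedModule)). apply (plus_zero_r (G := C_NormedModule)).
    + rewrite Nat.even_succ, <- Nat.negb_even, Nat.even_mul. reflexivity. }
unfold is_pseries, is_series. eapply filterlim_ext.
{ intro n. symmetry. apply E. }
refine (filterlim_comp _ _ _ Nat.div2 _ eventually eventually _ _ H).
intros P [N HN]. exists (2 * N)%nat. intros n Hn. apply HN.
apply Nat.div2_le_mono in Hn. now rewrite Nat.div2_double in Hn.
Qed.

Lemma pseries_vanish_right_0 (d : nat -> R) :
  (forall x, 0 < x -> is_pseries d x 0) -> d 0%nat = 0.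
Proof.
intro H.
assert (Hr : Rbar_lt 0 (CV_radius d)).
{ apply Rbar_lt_le_trans with 1; [exact Rlt_0_1|].
  apply Rbar_not_lt_le. intro Hlt.
  assert (Hl : Rbar_lt (CV_radius d) (Rabs 1)) by now rewrite Rabs_R1.
  apply (CV_disk_outside _ _ Hl). apply ex_series_lim_0.
  exists 0. apply (proj1 (is_pseries_R d 1 0)), H. lra. }
assert (Hc : continuity_pt (PSeries d) 0).
{ apply PSeries_continuity. now rewrite Rabs_R0. }
assert (L : is_lim_seq (fun n => PSeries d (/ INR (S n))) (PSeries d 0)).
{ apply is_lim_seq_continuous; [exact Hc|exact is_lim_seq_inv_S]. }
assert (L0 : is_lim_seq (fun n => PSeries d (/ INR (S n))) 0).
{ apply is_lim_seq_ext with (fun _ => 0); [|apply is_lim_seq_const].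
  intro n. symmetry. apply is_pseries_unique, H, Rinv_0_lt_compat, lt_0_INR. lia. }
apply is_lim_seq_unique in L. apply is_lim_seq_unique in L0.
rewrite L in L0. injection L0. rewrite PSeries_0. easy.
Qed.

Lemma pseries_vanish_right (d : nat -> R) :
  (forall x, 0 < x -> is_pseries d x 0) -> forall n, d n = 0.
Proof.
intros H n. revert d H. induction n as [|n IH]; intros d H.
- now apply pseries_vanish_right_0.
- apply (IH (fun n => d (S n))). intros x Hx.
  replace 0 with (scal (/ x) (plus 0 (opp (d 0%nat)))).
  2:{ rewrite (pseries_vanish_right_0 d H). change (/ x * (0 + - 0) = 0). ring. }
  apply (is_pseries_decr_1 (K := R_AbsRing) (V := R_NormedModule)).
  + change (/ x * x = 1). field. lra.
  + now apply H.
Qed.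

Lemma is_cpseries_real_point (a : nat -> C) (x : R) (l : C) :
  is_cpseries a (RtoC x) l ->
  is_pseries (fun n => Re (a n)) x (Re l) /\ is_pseries (fun n => Im (a n)) x (Im l).
Proof.
intro H. apply is_series_C_components in H. destruct H as [H1 H2].
assert (E : forall n, pow_n (K := C_AbsRing) (RtoC x) n = RtoC (x ^ n)).
{ intro n. symmetry. apply RtoC_pow. }
split; apply is_pseries_R.
- revert H1. apply is_series_ext. intro n. rewrite E.
  change (Re (RtoC (x ^ n) * a n) = Re (a n) * x ^ n). unfold Re. simpl. ring.
- revert H2. apply is_series_ext. intro n. rewrite E.
  change (Im (RtoC (x ^ n) * a n) = Im (a n) * x ^ n). unfold Im. simpl. ring.
Qed.

(** The difference vanishes at positive reals, so the real and imaginary parts of its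
    coefficients vanish one after the other: each is the limit at 0 from the right of the
    series left after dividing by x. *)
Theorem entire_identity (f g : C -> C) :
  entire f -> entire g -> (forall x, 0 < x -> f (RtoC x) = g (RtoC x)) ->
  forall z, f z = g z.
Proof.
intros [a Ha] [b Hb] E z.
pose (d := PS_minus (V := C_NormedModule) a b).
assert (Hd : forall x, 0 < x -> is_cpseries d (RtoC x) (RtoC 0)).
{ intros x Hx. replace (RtoC 0) with (plus (f (RtoC x)) (opp (g (RtoC x)))).
  - apply (is_pseries_minus (K := C_AbsRing) (V := C_NormedModule)); [apply Ha|apply Hb].
  - rewrite E by easy. apply (plus_opp_r (G := C_NormedModule)). }
assert (Eab : forall n, a n = b n).
{ intro n.
  assert (E1 := pseries_vanish_right _ (fun x Hx => proj1 (is_cpseries_real_point _ _ _ (Hd x Hx))) n).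
  assert (E2 := pseries_vanish_right _ (fun x Hx => proj2 (is_cpseries_real_point _ _ _ (Hd x Hx))) n).
  cbv beta in E1, E2.
  unfold d, PS_minus, PS_plus, PS_opp in E1, E2.
  destruct (a n) as [a1 a2], (b n) as [b1 b2].
  change (a1 + - b1 = 0) in E1. change (a2 + - b2 = 0) in E2. f_equal; lra. }
apply (filterlim_locally_unique (F := eventually) _ _ _ (Ha z)).
exact (is_pseries_ext (K := C_AbsRing) (V := C_NormedModule) _ _ _ _
  (fun n => eq_sym (Eab n)) (Hb z)).
Qed.

(** * The Gamma function *)

Definition gamma_integrand (x t : R) : R := Rpower t (x - 1) * exp (- t).

Lemma is_derive_Rpower (t y : R) : 0 < t -> is_derive (fun u => Rpower u y) t (y * Rpower t (y - 1)).
Proof.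
intro Ht. apply is_derive_Reals. apply derivable_pt_lim_power. exact Ht.
Qed.

Lemma gamma_integrand_continuous (x t : R) : 0 < t -> continuous (gamma_integrand x) t.
Proof.
intro Ht. apply (ex_derive_continuous (V := R_NormedModule)).
eexists. apply (is_derive_mult (fun u => Rpower u (x - 1)) (fun u => exp (- u))).
- now apply is_derive_Rpower.
- apply (is_derive_comp exp Ropp); [apply is_derive_Reals, derivable_pt_lim_exp|].
  apply (is_derive_opp (V := R_NormedModule) (fun u => u)), is_derive_id.
- exact Rmult_comm.
Qed.

Lemma ex_RInt_gamma_integrand (x a b : R) : 0 < a -> 0 < b -> ex_RInt (gamma_integrand x) a b.
Proof.
intros Ha Hb. apply (ex_RInt_continuous (V := R_CompleteNormedModule)). intros t Ht.
apply gamma_integrand_continuous. apply Rlt_le_trans with (2 := proj1 Ht).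
now apply Rmin_glb_lt.
Qed.

Lemma gamma_integrand_pos (x t : R) : 0 < gamma_integrand x t.
Proof. apply Rmult_lt_0_compat; apply exp_pos. Qed.

Lemma pow_le_fact_exp (n : nat) (t : R) : 0 <= t -> t ^ n <= INR (fact n) * exp t.
Proof.
intro Ht. assert (H := exp_ge_taylor t n Ht).
assert (Hf := INR_fact_lt_0 n).
assert (H1 : t ^ n / INR (fact n) <= exp t).
{ apply Rle_trans with (2 := H). destruct n as [|n]; [simpl; lra|].
  simpl sum_f_R0. assert (0 <= sum_f_R0 (fun k => t ^ k / INR (fact k)) n).
  { apply cond_pos_sum. intro k. apply Rdiv_le_0_compat; [now apply pow_le|apply INR_fact_lt_0]. }
  simpl in *. lra. }
apply Rmult_le_reg_r with (/ INR (fact n)); [now apply Rinv_0_lt_compat|].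
replace (INR (fact n) * exp t * / INR (fact n)) with (exp t) by (field; lra). exact H1.
Qed.

(** The exponential series dominates t^n / n! for an integer n >= x. *)
Lemma Rpower_exp_bound (x : R) :
  exists K, 0 < K /\ forall t, 1 <= t -> Rpower t x * exp (- t) <= K.
Proof.
destruct (nfloor_ex (Rabs x)) as [n [_ Hn]]; [apply Rabs_pos|].
exists (INR (fact (n + 1))). split; [apply INR_fact_lt_0|]. intros t Ht.
apply Rmult_le_reg_r with (exp t); [apply exp_pos|].
rewrite Rmult_assoc, <- exp_plus, Rplus_opp_l, exp_0, Rmult_1_r.
apply Rle_trans with (t ^ (n + 1)); [|apply pow_le_fact_exp; lra].
rewrite <- Rpower_pow by lra. apply Rle_Rpower; [easy|].
rewrite plus_INR. simpl. generalize (Rle_abs x). lra.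
Qed.

(** The majorants are t^(x-1) on (0,1] and K / t^2 on [1,oo). *)
Lemma RInt_gamma_bounded (x : R) : 0 < x ->
  exists K, forall a b, 0 < a < 1 -> 1 < b -> RInt (gamma_integrand x) a b <= K.
Proof.
intro Hx. destruct (Rpower_exp_bound (x + 1)) as [K [HK0 HK]].
exists (/ x + K). intros a b Ha Hb.
rewrite <- (RInt_Chasles (gamma_integrand x) a 1 b)
  by (apply ex_RInt_gamma_integrand; lra).
change (RInt (gamma_integrand x) a 1 + RInt (gamma_integrand x) 1 b <= / x + K).
apply Rplus_le_compat.
- assert (I : is_RInt (fun t => Rpower t (x - 1)) a 1 (Rpower 1 x / x - Rpower a x / x)).
  { apply (is_RInt_derive (V := R_CompleteNormedModule) (fun t => Rpower t x / x)).
    - intros t Ht. rewrite Rmin_left, Rmax_right in Ht by lra.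
      replace (Rpower t (x - 1)) with (/ x * (x * Rpower t (x - 1))) by (field; lra).
      apply is_derive_ext with (fun u => / x * Rpower u x); [intro; unfold Rdiv; apply Rmult_comm|].
      apply is_derive_scal, is_derive_Rpower. lra.
    - intros t Ht. rewrite Rmin_left, Rmax_right in Ht by lra.
      apply (ex_derive_continuous (V := R_NormedModule)). eexists. apply is_derive_Rpower. lra. }
  apply Rle_trans with (RInt (fun t => Rpower t (x - 1)) a 1).
  + apply RInt_le; [lra|apply ex_RInt_gamma_integrand; lra|eexists; exact I|].
    intros t Ht. unfold gamma_integrand. rewrite <- Rmult_1_r.
    apply Rmult_le_compat_l; [apply Rlt_le, exp_pos|].
    rewrite <- exp_0. left. apply exp_increasing. lra.
  + rewrite (is_RInt_unique _ _ _ _ I).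
    assert (E1 : Rpower 1 x = 1) by (unfold Rpower; rewrite ln_1, Rmult_0_r; apply exp_0).
    rewrite E1. assert (0 < Rpower a x) by apply exp_pos.
    assert (0 < Rpower a x / x) by now apply Rdiv_lt_0_compat. unfold Rdiv at 1. lra.
- assert (I : is_RInt (fun t => K * / t ^ 2) 1 b (- K * / b - - K * / 1)).
  { apply (is_RInt_derive (V := R_CompleteNormedModule) (fun t => - K * / t)).
    - intros t Ht. rewrite Rmin_left, Rmax_right in Ht by lra.
      auto_derive; [lra|]. field. lra.
    - intros t Ht. rewrite Rmin_left, Rmax_right in Ht by lra.
      apply (ex_derive_continuous (V := R_NormedModule)). auto_derive.
      apply Rmult_integral_contrapositive_currified; lra. }
  apply Rle_trans with (RInt (fun t => K * / t ^ 2) 1 b).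
  + apply RInt_le; [lra|apply ex_RInt_gamma_integrand; lra|eexists; exact I|].
    intros t Ht. unfold gamma_integrand.
    apply Rmult_le_reg_r with (t ^ 2); [apply pow_lt; lra|].
    rewrite (Rmult_assoc K), Rinv_l, Rmult_1_r by (apply pow_nonzero; lra).
    apply Rle_trans with (2 := HK t ltac:(lra)). right.
    replace (x + 1) with (x - 1 + INR 2) by (simpl; ring).
    rewrite Rpower_plus, Rpower_pow by lra. ring.
  + rewrite (is_RInt_unique _ _ _ _ I). rewrite Rinv_1.
    assert (0 < / b) by (apply Rinv_0_lt_compat; lra). nra.
Qed.

Lemma RInt_gamma_mono (x a0 a b0 b : R) :
  0 < a <= a0 -> a0 <= b0 <= b ->
  RInt (gamma_integrand x) a0 b0 <= RInt (gamma_integrand x) a b.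
Proof.
intros Ha Hb.
rewrite <- (RInt_Chasles (gamma_integrand x) a a0 b)
  by (apply ex_RInt_gamma_integrand; lra).
rewrite <- (RInt_Chasles (gamma_integrand x) a0 b0 b)
  by (apply ex_RInt_gamma_integrand; lra).
assert (P : forall u v, 0 < u <= v -> 0 <= RInt (gamma_integrand x) u v).
{ intros u v Hu. apply RInt_ge_0; [lra|apply ex_RInt_gamma_integrand; lra|].
  intros t _. apply Rlt_le, gamma_integrand_pos. }
assert (P1 := P a a0 ltac:(lra)). assert (P2 := P b0 b ltac:(lra)).
unfold plus; simpl. lra.
Qed.

(** The integrand is positive, so that the integrals over compact intervals increase with the
    interval and converge to their supremum. *)
Lemma is_RInt_gen_Gamma (x : R) : 0 < x ->
  is_RInt_gen (gamma_integrand x) (at_right 0) (Rbar_locally p_infty) (Gamma x) /\ 0 < Gamma x.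
Proof.
intro Hx.
pose (V := fun v => exists a b, 0 < a < 1 /\ 1 < b /\ v = RInt (gamma_integrand x) a b).
destruct (completeness V) as [L [Hub Hlub]].
- destruct (RInt_gamma_bounded x Hx) as [K HK]. exists K.
  intros v [a [b [Ha [Hb ->]]]]. now apply HK.
- exists (RInt (gamma_integrand x) (/ 2) 2). exists (/ 2), 2. repeat split; lra.
- assert (HL : is_RInt_gen (gamma_integrand x) (at_right 0) (Rbar_locally p_infty) L).
  { intros P [eps HP].
    assert (H : exists a0 b0, 0 < a0 < 1 /\ 1 < b0 /\ L - eps < RInt (gamma_integrand x) a0 b0).
    { apply Classical_Prop.NNPP. intro Hn. assert (He := cond_pos eps).
      assert (L <= L - eps); [|lra]. apply Hlub. intros v [a [b [Ha [Hb ->]]]].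
      apply Rnot_lt_le. intro Hlt. apply Hn. now exists a, b. }
    destruct H as [a0 [b0 [Ha0 [Hb0 H0]]]].
    exists (fun a => 0 < a < a0) (fun b => b0 < b).
    - exists (mkposreal a0 (proj1 Ha0)). intros a Hb Hpos.
      change (Rabs (a - 0) < a0) in Hb. rewrite Rminus_0_r in Hb. apply Rabs_def2 in Hb. lra.
    - now exists b0.
    - intros a b Ha Hb. exists (RInt (gamma_integrand x) a b). split.
      + apply (RInt_correct (V := R_CompleteNormedModule)), ex_RInt_gamma_integrand; simpl; lra.
      + apply HP. change (Rabs (RInt (gamma_integrand x) a b - L) < eps).
        assert (H1 : RInt (gamma_integrand x) a b <= L).
        { apply Hub. exists a, b. repeat split; simpl in *; lra. }
        assert (H2 : RInt (gamma_integrand x) a0 b0 <= RInt (gamma_integrand x) a b)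
          by (apply RInt_gamma_mono; simpl in *; lra).
        assert (He := cond_pos eps). apply Rabs_def1; lra. }
  assert (E : Gamma x = L).
  { change (RInt_gen (gamma_integrand x) (at_right 0) (Rbar_locally p_infty) = L).
    apply (is_RInt_gen_unique (V := R_CompleteNormedModule) (gamma_integrand x) L HL). }
  rewrite E. split; [exact HL|].
  apply Rlt_le_trans with (RInt (gamma_integrand x) (/ 2) 2).
  + apply RInt_gt_0; [lra|intros; apply gamma_integrand_pos|].
    intros t Ht. apply gamma_integrand_continuous. lra.
  + apply Hub. exists (/ 2), 2. repeat split; lra.
Qed.

Lemma Gamma_pos (x : R) : 0 < x -> 0 < Gamma x.
Proof. intro Hx. now apply is_RInt_gen_Gamma. Qed.

Lemma filterlim_Rpower_exp_0 (x : R) : 0 < x ->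
  filterlim (fun t => - (Rpower t x * exp (- t))) (at_right 0) (locally 0).
Proof.
intro Hx. apply filterlim_locally. intro eps.
assert (Hd : 0 < Rpower eps (/ x)) by apply exp_pos.
exists (mkposreal _ Hd). intros t Hb Ht.
change (Rabs (t - 0) < Rpower eps (/ x)) in Hb.
rewrite Rminus_0_r, Rabs_pos_eq in Hb by lra.
change (Rabs (- (Rpower t x * exp (- t)) - 0) < eps).
assert (He := cond_pos eps).
assert (H0 : 0 < Rpower t x) by apply exp_pos.
assert (H1 : Rpower t x < eps).
{ replace (pos eps) with (Rpower (Rpower eps (/ x)) x).
  - apply Rlt_Rpower_l; [easy|lra].
  - rewrite Rpower_mult, Rinv_l, Rpower_1; lra. }
assert (H2 : 0 < exp (- t) <= 1).
{ split; [apply exp_pos|]. rewrite <- exp_0. left. apply exp_increasing. lra. }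
rewrite Rminus_0_r, Rabs_Ropp, Rabs_pos_eq by nra. nra.
Qed.

Lemma filterlim_Rpower_exp_infty (x : R) :
  filterlim (fun t => - (Rpower t x * exp (- t))) (Rbar_locally p_infty) (locally 0).
Proof.
destruct (Rpower_exp_bound (x + 1)) as [K [HK0 HK]].
apply filterlim_locally. intro eps. assert (He := cond_pos eps).
exists (Rmax 1 (K / eps)). intros t Ht.
assert (H1 := Rmax_l 1 (K / eps)). assert (H2 := Rmax_r 1 (K / eps)).
assert (Ht1 : 1 <= t) by lra.
specialize (HK t Ht1).
change (Rabs (- (Rpower t x * exp (- t)) - 0) < eps).
assert (H0 : 0 < Rpower t x * exp (- t)) by (apply Rmult_lt_0_compat; apply exp_pos).
rewrite Rminus_0_r, Rabs_Ropp, Rabs_pos_eq by lra.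
rewrite Rpower_plus, Rpower_1 in HK by lra.
assert (HKt : K < eps * t).
{ apply Rle_lt_trans with (eps * (K / eps)); [right; field; lra|].
  apply Rmult_lt_compat_l; lra. }
apply Rmult_lt_reg_r with t; [lra|].
replace (Rpower t x * exp (- t) * t) with (Rpower t x * t * exp (- t)) by ring. lra.
Qed.

(** Integration by parts: - t^x exp(-t) has limit 0 at both ends. *)
Lemma Gamma_succ (x : R) : 0 < x -> Gamma (x + 1) = x * Gamma x.
Proof.
intro Hx.
pose (g := fun t => - (Rpower t x * exp (- t))).
assert (Dg : forall t, 0 < t ->
  is_derive g t (gamma_integrand (x + 1) t - x * gamma_integrand x t)).
{ intros t Ht.
  replace (gamma_integrand (x + 1) t - x * gamma_integrand x t) with
    (opp (plus (mult (x * Rpower t (x - 1)) (exp (- t)))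
               (mult (Rpower t x) (scal (opp one) (exp (- t)))))).
  2:{ change (- (x * Rpower t (x - 1) * exp (- t) + Rpower t x * ((- (1)) * exp (- t))) =
        Rpower t (x + 1 - 1) * exp (- t) - x * (Rpower t (x - 1) * exp (- t))).
      replace (x + 1 - 1) with x by ring. ring. }
  apply (is_derive_opp (V := R_NormedModule)).
  apply (is_derive_mult (fun u => Rpower u x) (fun u => exp (- u))).
  - now apply is_derive_Rpower.
  - apply (is_derive_comp exp Ropp); [apply is_derive_Reals, derivable_pt_lim_exp|].
    apply (is_derive_opp (V := R_NormedModule) (fun u => u)), is_derive_id.
  - exact Rmult_comm. }
assert (Hpos : filter_prod (at_right 0) (Rbar_locally p_infty)
  (fun ab : R * R => 0 < fst ab /\ 0 < snd ab)).
{ exists (fun a => 0 < a) (fun b => 0 < b).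
  - exists (mkposreal 1 Rlt_0_1). intros a _ Ha. exact Ha.
  - now exists 0.
  - intros a b Ha Hb. now split. }
assert (I0 : is_RInt_gen (Derive g) (at_right 0) (Rbar_locally p_infty) (0 - 0)).
{ apply (is_RInt_gen_Derive g 0 0).
  - revert Hpos. apply filter_imp. intros [a b] [Ha Hb] t Ht. simpl in *.
    eexists. apply Dg. apply Rlt_le_trans with (2 := proj1 Ht). now apply Rmin_glb_lt.
  - revert Hpos. apply filter_imp. intros [a b] [Ha Hb] t Ht. simpl in *.
    assert (Ht0 : 0 < t)
      by (apply Rlt_le_trans with (2 := proj1 Ht); now apply Rmin_glb_lt).
    apply continuous_ext_loc with
      (fun t => gamma_integrand (x + 1) t - x * gamma_integrand x t).
    + exists (mkposreal t Ht0). intros u Hu. change (Rabs (u - t) < t) in Hu.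
      symmetry. apply is_derive_unique, Dg. apply Rabs_def2 in Hu. lra.
    + apply (continuous_minus (V := R_NormedModule)); [now apply gamma_integrand_continuous|].
      apply (continuous_scal_r (V := R_NormedModule)). now apply gamma_integrand_continuous.
  - now apply filterlim_Rpower_exp_0.
  - apply filterlim_Rpower_exp_infty. }
destruct (is_RInt_gen_Gamma x Hx) as [I1 _].
destruct (is_RInt_gen_Gamma (x + 1)) as [I2 _]; [lra|].
assert (I3 := is_RInt_gen_minus (V := R_NormedModule) _ _ _ _ I2
  (is_RInt_gen_scal (V := R_NormedModule) _ x _ I1)).
assert (I4 : is_RInt_gen (Derive g) (at_right 0) (Rbar_locally p_infty)
  (minus (Gamma (x + 1)) (scal x (Gamma x)))).
{ revert I3. apply (is_RInt_gen_ext (V := R_NormedModule)).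
  revert Hpos. apply filter_imp. intros [a b] [Ha Hb] t Ht. simpl in *.
  symmetry. apply is_derive_unique, Dg.
  apply Rlt_trans with (2 := proj1 Ht). now apply Rmin_glb_lt. }
assert (U0 := is_RInt_gen_unique (V := R_CompleteNormedModule) _ _ I0).
assert (U4 := is_RInt_gen_unique (V := R_CompleteNormedModule) _ _ I4).
rewrite U0 in U4. change (0 - 0 = Gamma (x + 1) - x * Gamma x) in U4. lra.
Qed.

Lemma Gamma_poch (x : R) (n : nat) : 0 < x -> Gamma (x + INR n) = poch x n * Gamma x.
Proof.
intro Hx. induction n as [|n IH]; [simpl; rewrite Rplus_0_r; ring|].
rewrite S_INR. simpl poch. rewrite <- Rplus_assoc, Gamma_succ, IH; [ring|].
generalize (pos_INR n). lra.
Qed.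

(** * The cross product of the Bessel functions *)

Definition bessel_coef (nu : R) (n : nat) : R := / (INR (fact n) * poch (nu + 1) n).
(** Up to a factor (x/2)^nu / Gamma(nu+1), [alt_bessel_coef] and [bessel_coef] are the
    coefficients of J_nu and I_nu in powers of x^2/4. *)
Definition alt_bessel_coef (nu : R) (n : nat) : R := (-1) ^ n * bessel_coef nu n.

(** The Bessel differential equation on the level of coefficients. *)
Lemma bessel_coef_succ (nu : R) (n : nat) : -1 < nu ->
  INR (S n) * (INR (S n) + nu) * bessel_coef nu (S n) = bessel_coef nu n.
Proof.
intro Hnu. unfold bessel_coef. rewrite INR_fact_S, S_INR. cbn [poch].
assert (Hn := pos_INR n).
field. repeat split; try lra.
- apply Rgt_not_eq, poch_pos; lra.
- apply INR_fact_neq_0.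
Qed.

(** The weight w receives both indices k and l of the Cauchy product j_k i_l with k + l = N; polynomial
    weights correspond to Euler derivatives of the two factors. *)
Definition weighted_conv (nu : R) (w : R -> R -> R) (N : nat) : R :=
  sum_f_R0 (fun k => w (INR k) (INR (N - k)) * (alt_bessel_coef nu k * bessel_coef nu (N - k))) N.

Lemma weighted_conv_lin (nu a b : R) (v w : R -> R -> R) (N : nat) :
  a * weighted_conv nu v N + b * weighted_conv nu w N =
  weighted_conv nu (fun k l => a * v k l + b * w k l) N.
Proof.
unfold weighted_conv. rewrite !scal_sum, <- plus_sum. apply sum_eq. intros; ring.
Qed.

Lemma weighted_conv_ext (nu : R) (v w : R -> R -> R) (N : nat) :
  (forall k l, k + l = INR N -> v k l = w k l) ->
  weighted_conv nu v N = weighted_conv nu w N.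
Proof.
intro H. apply sum_eq. intros k Hk. f_equal. apply H. rewrite minus_INR by easy. ring.
Qed.

Lemma weighted_conv_right (nu : R) (w : R -> R -> R) (N : nat) : -1 < nu ->
  weighted_conv nu (fun k l => l * (l + nu) * w k l) (S N) =
  weighted_conv nu (fun k l => w k (l + 1)) N.
Proof.
intro Hnu. unfold weighted_conv. rewrite tech5, Nat.sub_diag. simpl (INR 0).
replace (0 * (0 + nu) * w (INR (S N)) 0 * (alt_bessel_coef nu (S N) * bessel_coef nu 0))
  with 0 by ring.
rewrite Rplus_0_r. apply sum_eq. intros k Hk.
replace (S N - k)%nat with (S (N - k)) by lia.
rewrite <- (bessel_coef_succ nu (N - k) Hnu), <- S_INR. ring.
Qed.

Lemma weighted_conv_left (nu : R) (w : R -> R -> R) (N : nat) : -1 < nu ->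
  weighted_conv nu (fun k l => k * (k + nu) * w k l) (S N) =
  - weighted_conv nu (fun k l => w (k + 1) l) N.
Proof.
intro Hnu. unfold weighted_conv. rewrite decomp_sum by lia. simpl pred. simpl (INR 0).
rewrite !Rmult_0_l, Rplus_0_l.
replace (- sum_f_R0 _ N) with (-1 * sum_f_R0 (fun k => w (INR k + 1) (INR (N - k)) *
  (alt_bessel_coef nu k * bessel_coef nu (N - k))) N) by ring.
rewrite scal_sum. apply sum_eq. intros k Hk.
replace (S N - S k)%nat with (N - k)%nat by lia.
unfold alt_bessel_coef. rewrite <- (bessel_coef_succ nu k Hnu), <- S_INR. simpl pow. ring.
Qed.

(** The coefficients of t (j i' - j' i). *)
Definition cross_coef (nu : R) := weighted_conv nu (fun k l => l - k).

(** On k + l = N+1 one has l(l+nu) - k(k+nu) = (l-k)(N+1+nu), and [bessel_coef_succ] reduces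
    each of the two products on the left to a sum over k + l = N. *)
Lemma cross_coef_succ (nu : R) (N : nat) : -1 < nu ->
  (INR (S N) + nu) * cross_coef nu (S N) = 2 * weighted_conv nu (fun _ _ => 1) N.
Proof.
intro Hnu. unfold cross_coef.
assert (H1 := weighted_conv_right nu (fun _ _ => 1) N Hnu).
assert (H2 := weighted_conv_left nu (fun _ _ => 1) N Hnu). cbv beta in H1, H2.
replace (2 * weighted_conv nu (fun _ _ => 1) N)
  with (1 * weighted_conv nu (fun _ _ => 1) N + -1 * - weighted_conv nu (fun _ _ => 1) N) by ring.
rewrite <- H2, <- H1, weighted_conv_lin.
rewrite <- (Rplus_0_r (_ * _)), <- (Rmult_0_l (weighted_conv nu (fun _ _ => 1) (S N))).
rewrite weighted_conv_lin. apply weighted_conv_ext. intros k l E. rewrite <- E. ring.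
Qed.

(** Combines two evaluations of the sum Q with weight (l-k)^2.  On k + l = n one has
    2 (l(l+nu) + k(k+nu)) = (l-k)^2 + n^2 + 2 nu n, and the two parts of the reduced sum
    cancel because of the alternating sign; and (n+nu)(l-k)^2 is l-k times the difference used in
    [cross_coef_succ]. *)
Lemma product_coef_succ (nu : R) (N : nat) : -1 < nu ->
  (INR (S N) + nu) * INR (S N) * (INR (S N) + 2 * nu) * weighted_conv nu (fun _ _ => 1) (S N)
  = - 2 * cross_coef nu N.
Proof.
intro Hnu. unfold cross_coef.
assert (H1 := weighted_conv_right nu (fun _ _ => 1) N Hnu).
assert (H2 := weighted_conv_left nu (fun _ _ => 1) N Hnu).
assert (H3 := weighted_conv_right nu (fun k l => l - k) N Hnu).
assert (H4 := weighted_conv_left nu (fun k l => l - k) N Hnu). cbv beta in H1, H2, H3, H4.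
set (n := INR (S N)) in *.
set (P := weighted_conv nu (fun _ _ => 1)) in *.
set (Q := weighted_conv nu (fun k l => (l - k) ^ 2) (S N)).
assert (E1 : Q + (n * n + 2 * nu * n) * P (S N) = 0).
{ replace 0 with (2 * P N + 2 * - P N) by ring. rewrite <- H2, <- H1. unfold P.
  rewrite weighted_conv_lin, <- (Rmult_1_l Q). unfold Q. rewrite weighted_conv_lin.
  apply weighted_conv_ext. intros k l E. unfold n. rewrite <- E. ring. }
assert (E2 : (n + nu) * Q = 2 * weighted_conv nu (fun k l => l - k) N).
{ transitivity (1 * weighted_conv nu (fun k l => l * (l + nu) * (l - k)) (S N)
    + -1 * weighted_conv nu (fun k l => k * (k + nu) * (l - k)) (S N)).
  - rewrite weighted_conv_lin. unfold Q.
    rewrite <- (Rplus_0_r (_ * _)), <- (Rmult_0_l (weighted_conv nu (fun _ _ => 1) (S N))).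
    rewrite weighted_conv_lin. apply weighted_conv_ext. intros k l E. unfold n.
    rewrite <- E. ring.
  - rewrite H3, H4. replace (-1 * - weighted_conv nu (fun k l => l - (k + 1)) N)
      with (1 * weighted_conv nu (fun k l => l - (k + 1)) N) by ring.
    rewrite weighted_conv_lin.
    rewrite <- (Rplus_0_r (2 * _)), <- (Rmult_0_l (weighted_conv nu (fun _ _ => 1) N)).
    rewrite weighted_conv_lin. apply weighted_conv_ext. intros k l E. ring. }
transitivity ((n + nu) * (- Q)); [|rewrite <- Ropp_mult_distr_r, E2; ring].
replace (- Q) with ((n * n + 2 * nu * n) * P (S N)) by lra. ring.
Qed.

Lemma cross_coef_0 (nu : R) : cross_coef nu 0 = 0.
Proof. unfold cross_coef, weighted_conv. simpl. ring. Qed.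

Lemma cross_coef_1 (nu : R) : -1 < nu -> cross_coef nu 1 = 2 / (nu + 1).
Proof.
intro Hnu. assert (H := cross_coef_succ nu 0 Hnu). unfold weighted_conv in H. simpl in H.
unfold alt_bessel_coef, bessel_coef in H. simpl in H. rewrite Rmult_1_r, Rinv_1 in H.
apply Rmult_eq_reg_l with (1 + nu); [|lra]. rewrite H. field. lra.
Qed.

(** Computed directly, because the recurrence from index 0 degenerates at nu = -1/2. *)
Lemma cross_coef_2 (nu : R) : -1 < nu -> cross_coef nu 2 = 0.
Proof.
intro Hnu. assert (H := cross_coef_succ nu 1 Hnu). unfold weighted_conv in H. simpl in H.
unfold alt_bessel_coef in H. simpl in H.
apply Rmult_eq_reg_l with (1 + 1 + nu); [|lra]. rewrite H. ring.
Qed.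

Lemma cross_coef_step (nu : R) (N : nat) : -1 < nu ->
  (INR N + 2 + nu) * (INR N + 1 + nu) * (INR N + 1) * (INR N + 1 + 2 * nu) * cross_coef nu (S (S N))
  = - 4 * cross_coef nu N.
Proof.
intro Hnu. assert (H1 := cross_coef_succ nu (S N) Hnu).
assert (H2 := product_coef_succ nu N Hnu). rewrite !S_INR in H1. rewrite !S_INR in H2.
replace ((INR N + 2 + nu) * (INR N + 1 + nu) * (INR N + 1) * (INR N + 1 + 2 * nu)
    * cross_coef nu (S (S N)))
  with ((INR N + 1 + nu) * (INR N + 1) * (INR N + 1 + 2 * nu)
    * ((INR N + 1 + 1 + nu) * cross_coef nu (S (S N)))) by ring.
rewrite H1. replace (-4 * cross_coef nu N) with (2 * (-2 * cross_coef nu N)) by ring.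
rewrite <- H2. ring.
Qed.

Lemma cross_coef_even (nu : R) (n : nat) : -1 < nu -> cross_coef nu (2 * n) = 0.
Proof.
intro Hnu. induction n as [|n IH]; [apply cross_coef_0|].
destruct n as [|n]; [now apply cross_coef_2|].
replace (2 * S (S n))%nat with (S (S (2 * S n))) by lia.
assert (H := cross_coef_step nu (2 * S n) Hnu). rewrite IH, Rmult_0_r in H.
assert (Hn : 2 <= INR (2 * S n)).
{ rewrite mult_INR, (S_INR n). simpl (INR 2). generalize (pos_INR n). lra. }
apply Rmult_integral in H. destruct H as [H|H]; [exfalso|exact H].
revert H. apply Rgt_not_eq. repeat apply Rmult_lt_0_compat; lra.
Qed.

Lemma cross_coef_odd (nu : R) (n : nat) : -1 < nu ->
  cross_coef nu (2 * n + 1) = 2 / (nu + 1) * (16 ^ n * bessel_product_coef nu n).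
Proof.
intro Hnu. unfold bessel_product_coef. induction n as [|n IH].
- simpl. rewrite cross_coef_1 by easy. field. lra.
- replace (2 * S n + 1)%nat with (S (S (2 * n + 1))) by lia.
  assert (H := cross_coef_step nu (2 * n + 1) Hnu). rewrite IH in H.
  assert (Hn := pos_INR n).
  assert (E : INR (2 * n + 1) = 2 * INR n + 1) by (rewrite plus_INR, mult_INR; simpl; ring).
  rewrite E in H.
  apply Rmult_eq_reg_l with ((2 * INR n + 1 + 2 + nu) * (2 * INR n + 1 + 1 + nu)
    * (2 * INR n + 1 + 1) * (2 * INR n + 1 + 1 + 2 * nu)).
  + rewrite H. replace (2 * S n)%nat with (S (S (2 * n))) by lia.
    cbn [poch]. rewrite INR_fact_S, !S_INR, mult_INR. simpl (INR 2). simpl pow. field.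
    repeat split; try lra.
    * apply Rgt_not_eq, poch_pos; lra.
    * apply Rgt_not_eq, poch_pos; lra.
    * apply INR_fact_neq_0.
    * apply pow_nonzero; lra.
  + apply Rgt_not_eq. repeat apply Rmult_lt_0_compat; lra.
Qed.

Lemma alt_bessel_coef_entire (nu : R) : -1 < nu -> entire_coef (alt_bessel_coef nu).
Proof.
intro Hnu. apply laguerre_polya_entire.
apply laguerre_polya_ext with (fun n => (-1) ^ n / INR (fact n) / poch (nu + 1) n).
- intro n. unfold alt_bessel_coef, bessel_coef. field. split; [|apply INR_fact_neq_0].
  apply Rgt_not_eq, poch_pos. lra.
- apply laguerre_polya_div_poch; [lra|exact laguerre_polya_exp].
Qed.

Lemma bessel_coef_entire (nu : R) : -1 < nu -> entire_coef (bessel_coef nu).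
Proof.
intro Hnu. apply entire_coef_le with (2 := alt_bessel_coef_entire nu Hnu). intro n.
unfold alt_bessel_coef. rewrite Rabs_mult, pow_1_abs. lra.
Qed.

(** Both Bessel series at once: a n is (-1)^n for J_nu and 1 for I_nu. *)
Lemma bessel_series (nu x : R) (a : nat -> R) : -1 < nu -> 0 < x ->
  Series (fun n => a n / (INR (fact n) * Gamma (nu + INR n + 1)) * Rpower (x / 2) (nu + 2 * INR n))
  = / Gamma (nu + 1) * Rpower (x / 2) nu * PSeries (fun n => a n * bessel_coef nu n) (x ^ 2 / 4).
Proof.
intros Hnu Hx. unfold PSeries. rewrite <- Series_scal_l. apply Series_ext. intro n.
replace (nu + INR n + 1) with (nu + 1 + INR n) by ring.
rewrite Gamma_poch by lra. unfold bessel_coef.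
replace (2 * INR n) with (INR (2 * n)) by (rewrite mult_INR; reflexivity).
rewrite Rpower_plus, Rpower_pow by lra. rewrite pow_mult.
replace ((x / 2) ^ 2) with (x ^ 2 / 4) by field.
field. repeat split.
- apply Rgt_not_eq, poch_pos. lra.
- apply INR_fact_neq_0.
- apply Rgt_not_eq, Gamma_pos. lra.
Qed.

Definition bessel_form (K nu : R) (c : nat -> R) (x : R) : R :=
  K * Rpower (x / 2) nu * PSeries c (x ^ 2 / 4).

Lemma Derive_bessel_form (f : R -> R) (K nu : R) (c : nat -> R) (x : R) :
  (forall u, 0 < u -> f u = bessel_form K nu c u) -> entire_coef c -> 0 < x ->
  Derive f x = K * Rpower (x / 2) nu *
    (nu / x * PSeries c (x ^ 2 / 4) + x / 2 * PSeries (PS_derive c) (x ^ 2 / 4)).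
Proof.
intros Hf Hc Hx. apply is_derive_unique.
apply is_derive_ext_loc with (bessel_form K nu c).
{ exists (mkposreal x Hx). intros u Hu. change (Rabs (u - x) < x) in Hu.
  symmetry. apply Hf. apply Rabs_def2 in Hu. lra. }
assert (D1 : is_derive (fun u => Rpower (u / 2) nu) x (nu / x * Rpower (x / 2) nu)).
{ replace (nu / x * Rpower (x / 2) nu) with (/ 2 * (nu * Rpower (x / 2) (nu - 1))).
  - apply (is_derive_comp (fun u => Rpower u nu) (fun u => u / 2)).
    + apply is_derive_Rpower. lra.
    + auto_derive; [easy|]. field.
  - unfold Rminus. rewrite Rpower_plus, Rpower_Ropp, Rpower_1 by lra. field. lra. }
assert (D2 : is_derive (fun u => PSeries c (u ^ 2 / 4)) x (x / 2 * PSeries (PS_derive c) (x ^ 2 / 4))).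
{ apply (is_derive_comp (PSeries c) (fun u => u ^ 2 / 4)).
  - apply is_derive_PSeries. now rewrite entire_coef_radius.
  - auto_derive; [easy|]. field. }
unfold bessel_form.
replace (K * Rpower (x / 2) nu
    * (nu / x * PSeries c (x ^ 2 / 4) + x / 2 * PSeries (PS_derive c) (x ^ 2 / 4)))
  with (K * (nu / x * Rpower (x / 2) nu) * PSeries c (x ^ 2 / 4) +
        K * Rpower (x / 2) nu * (x / 2 * PSeries (PS_derive c) (x ^ 2 / 4))) by ring.
apply (is_derive_mult (fun u => K * Rpower (u / 2) nu) (fun u => PSeries c (u ^ 2 / 4))).
- now apply is_derive_scal.
- exact D2.
- exact Rmult_comm.
Qed.

(** The left side times t is the series of [cross_coef], of which only the odd part
    survives. *)
Lemma wronskian_series (nu t : R) : -1 < nu -> 0 < t ->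
  PSeries (alt_bessel_coef nu) t * PSeries (PS_derive (bessel_coef nu)) t
  - PSeries (PS_derive (alt_bessel_coef nu)) t * PSeries (bessel_coef nu) t
  = 2 / (nu + 1) * PSeries (bessel_product_coef nu) (16 * t ^ 2).
Proof.
intros Hnu Ht.
set (j := alt_bessel_coef nu). set (i := bessel_coef nu).
assert (Hj : entire_coef j) by now apply alt_bessel_coef_entire.
assert (Hi : entire_coef i) by now apply bessel_coef_entire.
assert (Hr : forall c, entire_coef c -> Rbar_lt (Rabs t) (CV_radius c)).
{ intros c Hc. now rewrite entire_coef_radius. }
apply Rmult_eq_reg_l with t; [|lra].
assert (E : forall n, cross_coef nu n =
  PS_mult j (fun n => INR n * i n) n - PS_mult (fun n => INR n * j n) i n).
{ intro n. unfold cross_coef, weighted_conv, PS_mult. rewrite <- minus_sum.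
  apply sum_eq. intros k Hk. unfold j, i. ring. }
assert (Hb : entire_coef (bessel_product_coef nu)).
{ now apply laguerre_polya_entire, laguerre_polya_bessel_product. }
assert (Ht2 : forall c, entire_coef c -> ex_pseries c (16 * t ^ 2)).
{ intros c Hc. now apply entire_coef_ex_pseries. }
assert (P0 : ex_pseries (fun n => cross_coef nu (2 * n)) (t ^ 2)).
{ apply entire_coef_ex_pseries. apply entire_coef_exp_bound with 0; [lra|]. intro n.
  rewrite cross_coef_even, Rabs_R0 by easy.
  apply Rdiv_le_0_compat; [apply pow_le; lra|apply INR_fact_lt_0]. }
assert (E1 : PSeries (fun n => cross_coef nu (2 * n)) (t ^ 2) = 0).
{ rewrite (PSeries_ext _ (fun _ => 0)); [apply PSeries_const_0|].
  intro n. now apply cross_coef_even. }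
assert (Eo : forall n, 2 / (nu + 1) * (bessel_product_coef nu n * (16 * t ^ 2) ^ n) =
  cross_coef nu (2 * n + 1) * (t ^ 2) ^ n).
{ intro n. rewrite cross_coef_odd, Rpow_mult_distr by easy. ring. }
assert (P1 : ex_pseries (fun n => cross_coef nu (2 * n + 1)) (t ^ 2)).
{ apply (ex_pseries_R (fun n => cross_coef nu (2 * n + 1)) (t ^ 2)).
  apply ex_series_ext with (1 := Eo).
  apply (ex_series_scal (V := R_NormedModule)).
  apply (ex_pseries_R (bessel_product_coef nu) (16 * t ^ 2)). now apply Ht2. }
assert (E2 : PSeries (fun n => cross_coef nu (2 * n + 1)) (t ^ 2) =
  2 / (nu + 1) * PSeries (bessel_product_coef nu) (16 * t ^ 2)).
{ unfold PSeries. rewrite <- Series_scal_l. symmetry. now apply Series_ext. }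
transitivity (PSeries (cross_coef nu) t).
- transitivity (PSeries (PS_minus (PS_mult j (fun n => INR n * i n))
    (PS_mult (fun n => INR n * j n) i)) t); [|symmetry; apply PSeries_ext; exact E].
  rewrite PSeries_minus.
  + rewrite !PSeries_mult by (apply Hr; first [assumption|now apply entire_coef_INR]).
    rewrite !PSeries_INR. fold j i. ring.
  + assert (K := is_pseries_mult j (fun n => INR n * i n) t _ _
     (entire_coef_pseries j t Hj) (entire_coef_pseries _ t (entire_coef_INR i Hi))
     (Hr _ Hj) (Hr _ (entire_coef_INR i Hi))).
    eexists. exact K.
  + assert (K := is_pseries_mult (fun n => INR n * j n) i t _ _
     (entire_coef_pseries _ t (entire_coef_INR j Hj)) (entire_coef_pseries i t Hi)
     (Hr _ (entire_coef_INR j Hj)) (Hr _ Hi)).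
    eexists. exact K.
- rewrite PSeries_odd_even by easy. rewrite E1, E2. ring.
Qed.

(** With J = K A j and I = K A i, where A = (x/2)^nu and j, i are series in x^2/4, the terms
    that differentiate A cancel and the cross product is K^2 A^2 (x/2)(j i' - j' i). *)
Lemma normalized_cross_product (nu x : R) : -1 < nu -> 0 < x ->
  Rpower 2 (2 * nu) * Rpower x (- 2 * nu) * Gamma (nu + 1) * Gamma (nu + 2) * Phi nu x
  = x * PSeries (bessel_product_coef nu) (x ^ 4).
Proof.
intros Hnu Hx.
set (K := / Gamma (nu + 1)).
assert (HJ : forall u, 0 < u -> bessel_J nu u = bessel_form K nu (alt_bessel_coef nu) u).
{ intros u Hu. unfold bessel_J. now apply bessel_series. }
assert (HI : forall u, 0 < u -> bessel_I nu u = bessel_form K nu (bessel_coef nu) u).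
{ intros u Hu. unfold bessel_I. rewrite (bessel_series nu u (fun _ => 1)) by easy.
  unfold bessel_form. f_equal. apply PSeries_ext. intro n. ring. }
unfold Phi. rewrite HJ, HI by easy.
rewrite (Derive_bessel_form _ K nu _ x HJ) by (try easy; now apply alt_bessel_coef_entire).
rewrite (Derive_bessel_form _ K nu _ x HI) by (try easy; now apply bessel_coef_entire).
unfold bessel_form.
set (t := x ^ 2 / 4). assert (Ht : 0 < t) by (unfold t; nra).
assert (W := wronskian_series nu t Hnu Ht).
replace (16 * t ^ 2) with (x ^ 4) in W by (unfold t; field).
set (A := Rpower (x / 2) nu).
assert (EA : Rpower 2 (2 * nu) * Rpower x (- 2 * nu) * (A * A) = 1).
{ unfold A, Rpower. rewrite ln_div, <- !exp_plus by lra. rewrite <- exp_0. f_equal. ring. }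
assert (EG : Gamma (nu + 2) = (nu + 1) * Gamma (nu + 1)).
{ rewrite <- Gamma_succ by lra. f_equal. ring. }
assert (HG := Gamma_pos (nu + 1) ltac:(lra)).
rewrite EG.
transitivity (Rpower 2 (2 * nu) * Rpower x (- 2 * nu) * (A * A) * (Gamma (nu + 1) * K) ^ 2
  * (nu + 1) * (x / 2) * (PSeries (alt_bessel_coef nu) t * PSeries (PS_derive (bessel_coef nu)) t
  - PSeries (PS_derive (alt_bessel_coef nu)) t * PSeries (bessel_coef nu) t)).
- field. lra.
- rewrite EA, W. unfold K. rewrite Rinv_r by lra. field. lra.
Qed.

(** * The normalized function and its derivative *)

(** The entire function g_nu; z^4 is a repeated product to suit the derivation rules. *)
Definition normalized_cross (nu : R) (z : C) : C :=
  (z * cseries (bessel_product_coef nu) (z * z * (z * z)))%C.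

Lemma entire_normalized_cross (nu : R) : -1 < nu -> entire (normalized_cross nu).
Proof.
intro Hnu.
pose (a := fun n => RtoC (bessel_product_coef nu n)).
exists (PS_incr_1 (V := C_NormedModule)
  (spread (V := C_NormedModule) (spread (V := C_NormedModule) a))).
intro z. apply (is_pseries_incr_1 (K := C_AbsRing) (V := C_NormedModule)).
apply is_pseries_spread, is_pseries_spread, is_cpseries_cseries.
now apply laguerre_polya_entire, laguerre_polya_bessel_product.
Qed.

Lemma is_g_nu_unique (nu : R) (g : C -> C) : -1 < nu -> is_g_nu nu g ->
  forall z, g z = normalized_cross nu z.
Proof.
intros Hnu [Hg Hx]. apply entire_identity; [exact Hg|now apply entire_normalized_cross|].
intros x Hx0. rewrite Hx, normalized_cross_product by easy. unfold normalized_cross.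
rewrite <- !RtoC_mult, cseries_RtoC, <- RtoC_mult. f_equal. f_equal. f_equal. ring.
Qed.

Lemma C_derive_normalized_cross (nu : R) (g : C -> C) (z : C) : -1 < nu ->
  (forall z, g z = normalized_cross nu z) ->
  C_derive g z = (cseries (bessel_product_coef nu) (z * z * (z * z))
    + 4 * cseries (fun n => (INR n * bessel_product_coef nu n)%R) (z * z * (z * z)))%C.
Proof.
intros Hnu Hg.
assert (Hc := laguerre_polya_entire _ (laguerre_polya_bessel_product nu Hnu)).
rewrite cseries_INR by easy.
set (F := cseries (bessel_product_coef nu)). set (F' := cseries (PS_derive (bessel_product_coef nu))).
apply is_C_derive_unique.
apply (is_derive_ext (K := C_AbsRing) (V := C_NormedModule) (normalized_cross nu)).
{ intro t. symmetry. apply Hg. }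
assert (D2 : is_derive (K := C_AbsRing) (V := AbsRing_NormedModule C_AbsRing) (fun t : C => (t * t)%C) z
  (one * z + z * one)%C).
{ exact (is_derive_mult (K := C_AbsRing) (fun t => t) (fun t => t) z _ _
    (is_derive_id (K := C_AbsRing) z) (is_derive_id (K := C_AbsRing) z) Cmult_comm). }
assert (D4 := is_derive_mult (K := C_AbsRing) _ _ _ _ _ D2 D2 Cmult_comm).
assert (DF := is_derive_comp (K := C_AbsRing) (V := C_NormedModule) F
  (fun t => (t * t * (t * t))%C) z _ _
  (is_derive_cseries _ (z * z * (z * z))%C Hc) D4).
apply is_derive_C_AbsRing in DF.
assert (D := is_derive_mult (K := C_AbsRing) (fun t => t)
  (fun t => F (t * t * (t * t))%C) z _ _ (is_derive_id z) DF Cmult_comm).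
match type of D with is_derive _ _ ?l =>
  replace (F (z * z * (z * z)) + 4 * (z * z * (z * z) * F' (z * z * (z * z))))%C with l
end.
- apply is_derive_C_AbsRing. exact D.
- fold F'. change ((1 * F (z * z * (z * z)) + z *
      (((1 * z + z * 1) * (z * z) + (z * z) * (1 * z + z * 1)) * F' (z * z * (z * z))))%C =
    (F (z * z * (z * z)) + 4 * (z * z * (z * z) * F' (z * z * (z * z))))%C).
  ring.
Qed.

(** * Rayleigh sums of the derivative *)

(** The coefficients of g_nu' in powers of z^4. *)
Definition deriv_coef (nu : R) (n : nat) : R := (4 * INR n + 1) * bessel_product_coef nu n.

Lemma laguerre_polya_deriv_coef (nu : R) : -1 < nu -> laguerre_polya (deriv_coef nu).
Proof.
intro Hnu. assert (Hb : 0 < / 4) by lra.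
generalize (laguerre_polya_euler _ (/ 4) Hb (laguerre_polya_bessel_product nu Hnu)).
apply laguerre_polya_ext. intro n. unfold deriv_coef. field.
Qed.

(** The polynomial that plays for the second Rayleigh sum the role of [nu_3] and [nu_4]. *)
Definition nu_2 (nu : R) : R := 16 * nu ^ 2 + 189 * nu + 473.

Section Numerics.
Context (nu : R) (Hnu : -1 < nu).

Lemma newton_deriv_coef :
  newton1 (deriv_coef nu) = 5 / (16 * poch (nu + 1) 3) /\
  newton2 (deriv_coef nu) = nu_2 nu / (2 ^ 8 * poch (nu + 1) 3 * poch (nu + 1) 5) /\
  newton3 (deriv_coef nu) = nu_3 nu / (2 ^ 11 * poch (nu + 1) 3 ^ 2 * poch (nu + 1) 7) /\
  newton4 (deriv_coef nu) = nu_4 nu / (2 ^ 16 * poch (nu + 1) 3 ^ 2 * poch (nu + 1) 5 * poch (nu + 1) 9).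
Proof.
unfold newton1, newton2, newton3, newton4, deriv_coef, bessel_product_coef, nu_2, nu_3, nu_4.
simpl. repeat split; field; lra.
Qed.

Lemma nu_2_pos : 0 < nu_2 nu.
Proof.
replace (nu_2 nu) with (300 + 157 * (nu + 1) + 16 * (nu + 1) ^ 2) by (unfold nu_2; ring).
assert (0 <= (nu + 1) ^ 2) by apply pow2_ge_0. lra.
Qed.

Ltac pos_poly :=
  repeat apply Rplus_lt_0_compat; repeat apply Rmult_lt_0_compat; try apply pow_lt; lra.

(** The Taylor coefficients at nu = -1 are positive; the same device proves all the
    polynomial inequalities below. *)
Lemma nu_3_pos : 0 < nu_3 nu.
Proof.
replace (nu_3 nu) with (22500 + 19350 * (nu + 1) + 5689 * (nu + 1) ^ 2
  + 696 * (nu + 1) ^ 3 + 32 * (nu + 1) ^ 4) by (unfold nu_3; ring).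
pos_poly.
Qed.

Lemma nu_4_pos : 0 < nu_4 nu.
Proof.
replace (nu_4 nu) with (151200000 + 254196000 * (nu + 1) + 180331600 * (nu + 1) ^ 2
  + 70625990 * (nu + 1) ^ 3 + 16758295 * (nu + 1) ^ 4 + 2479549 * (nu + 1) ^ 5
  + 224928 * (nu + 1) ^ 6 + 11520 * (nu + 1) ^ 7 + 256 * (nu + 1) ^ 8)
  by (unfold nu_4; ring).
pos_poly.
Qed.

(** After clearing the common Pochhammer factors, both differences are polynomials in nu + 1
    with positive coefficients. *)
Lemma newton_deriv_coef_strict :
  newton2 (deriv_coef nu) ^ 2 < newton1 (deriv_coef nu) * newton3 (deriv_coef nu) /\
  newton3 (deriv_coef nu) ^ 2 < newton2 (deriv_coef nu) * newton4 (deriv_coef nu).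
Proof.
destruct newton_deriv_coef as [-> [-> [-> ->]]].
assert (H3 := poch_pos (nu + 1) 3 ltac:(lra)). set (P := poch (nu + 1) 3) in *.
assert (E5 : poch (nu + 1) 5 = P * (nu + 4) * (nu + 5)) by (unfold P; simpl; ring).
assert (E7 : poch (nu + 1) 7 = P * (nu + 4) * (nu + 5) * (nu + 6) * (nu + 7))
  by (unfold P; simpl; ring).
assert (E9 : poch (nu + 1) 9 = P * (nu + 4) * (nu + 5) * (nu + 6) * (nu + 7) * (nu + 8) * (nu + 9))
  by (unfold P; simpl; ring).
rewrite E5, E7, E9. clearbody P. split; apply Rminus_gt_0_lt.
- match goal with |- 0 < ?X => replace X with
    ((10 * nu_3 nu * (nu + 4) * (nu + 5) - nu_2 nu ^ 2 * (nu + 6) * (nu + 7))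
     / (2 ^ 16 * P ^ 4 * ((nu + 4) * (nu + 5)) ^ 2 * (nu + 6) * (nu + 7))) by (field; lra) end.
  apply Rdiv_lt_0_compat; [|repeat first [apply Rmult_lt_0_compat|apply pow_lt]; lra].
  replace (10 * nu_3 nu * (nu + 4) * (nu + 5) - nu_2 nu ^ 2 * (nu + 6) * (nu + 7)) with
    (81000 * (nu + 1) + 108510 * (nu + 1) ^ 2 + 53591 * (nu + 1) ^ 3 + 12257 * (nu + 1) ^ 4
     + 1360 * (nu + 1) ^ 5 + 64 * (nu + 1) ^ 6) by (unfold nu_3, nu_2; ring).
  pos_poly.
- match goal with |- 0 < ?X => replace X with
    ((nu_2 nu * nu_4 nu * (nu + 6) * (nu + 7)
      - 4 * nu_3 nu ^ 2 * (nu + 4) * (nu + 5) * (nu + 8) * (nu + 9))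
     / (2 ^ 24 * P ^ 6 * ((nu + 4) * (nu + 5)) ^ 3 * ((nu + 6) * (nu + 7)) ^ 2 * (nu + 8) * (nu + 9)))
     by (field; lra) end.
  apply Rdiv_lt_0_compat; [|repeat first [apply Rmult_lt_0_compat|apply pow_lt]; lra].
  replace (nu_2 nu * nu_4 nu * (nu + 6) * (nu + 7)
      - 4 * nu_3 nu ^ 2 * (nu + 4) * (nu + 5) * (nu + 8) * (nu + 9))
    with (962640000 * (nu + 1) ^ 2 + 2192079600 * (nu + 1) ^ 3 + 2124808052 * (nu + 1) ^ 4
     + 1150777088 * (nu + 1) ^ 5 + 384858793 * (nu + 1) ^ 6 + 82949026 * (nu + 1) ^ 7
     + 11638117 * (nu + 1) ^ 8 + 1038640 * (nu + 1) ^ 9 + 54272 * (nu + 1) ^ 10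
     + 1280 * (nu + 1) ^ 11) by (unfold nu_3, nu_4, nu_2; ring).
  pos_poly.
Qed.
End Numerics.

(** * The radius of starlikeness *)

Lemma PSeries_deriv_coef (nu t : R) : -1 < nu ->
  PSeries (deriv_coef nu) t =
  PSeries (bessel_product_coef nu) t + 4 * PSeries (fun n => INR n * bessel_product_coef nu n) t.
Proof.
intro Hnu. assert (Hc := laguerre_polya_entire _ (laguerre_polya_bessel_product nu Hnu)).
rewrite <- PSeries_scal, <- PSeries_plus.
- apply PSeries_ext. intro n. unfold deriv_coef, PS_plus, PS_scal.
  change ((4 * INR n + 1) * bessel_product_coef nu n =
    bessel_product_coef nu n + 4 * (INR n * bessel_product_coef nu n)). ring.
- now apply entire_coef_ex_pseries.
- apply ex_pseries_scal; [apply Rmult_comm|].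
  now apply entire_coef_ex_pseries, entire_coef_INR.
Qed.

(** x F(x^4) vanishes at 0 and has derivative G(x^4), which is positive up to the first
    zero of G. *)
Lemma bessel_product_pos (nu rho : R) : -1 < nu ->
  (forall u, 0 <= u < rho -> 0 < PSeries (deriv_coef nu) u) ->
  forall u, 0 <= u < rho -> 0 < PSeries (bessel_product_coef nu) u.
Proof.
intros Hnu Hpos u Hu.
assert (Hlp := laguerre_polya_bessel_product nu Hnu).
assert (Hc := laguerre_polya_entire _ Hlp).
destruct (Req_dec u 0) as [->|Hne].
{ rewrite PSeries_0, (laguerre_polya_0 _ Hlp). lra. }
set (F := PSeries (bessel_product_coef nu)) in *.
set (x := Rpower u (/ 4)).
assert (Hx : 0 < x) by apply exp_pos.
assert (Ex : x ^ 4 = u).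
{ unfold x. rewrite <- Rpower_pow, Rpower_mult by apply exp_pos.
  replace (/ 4 * INR 4) with 1 by (simpl; field). apply Rpower_1. lra. }
assert (D : forall v, is_derive (fun v => v * F (v ^ 4)) v (PSeries (deriv_coef nu) (v ^ 4))).
{ intro v. rewrite PSeries_deriv_coef, PSeries_INR by easy. fold F.
  set (F' := PSeries (PS_derive (bessel_product_coef nu))).
  replace (F (v ^ 4) + 4 * (v ^ 4 * F' (v ^ 4))) with (1 * F (v ^ 4) + v * (4 * v ^ 3 * F' (v ^ 4)))
    by ring.
  apply (is_derive_mult (fun v => v) (fun v => F (v ^ 4))).
  - apply (is_derive_id (K := R_AbsRing)).
  - apply (is_derive_comp F (fun v => v ^ 4)).
    + apply is_derive_PSeries. now rewrite entire_coef_radius.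
    + auto_derive; [easy|]. ring.
  - exact Rmult_comm. }
destruct (MVT_gen (fun v => v * F (v ^ 4)) 0 x (fun v => PSeries (deriv_coef nu) (v ^ 4)))
  as [c [Hc' Hm]].
{ intros v _. apply D. }
{ intros v _. apply derivable_continuous_pt. eexists. apply is_derive_Reals, D. }
rewrite Rmin_left, Rmax_right in Hc' by lra. cbv beta in Hm. rewrite Ex in Hm.
assert (HP : 0 < PSeries (deriv_coef nu) (c ^ 4) \/ c = x).
{ destruct (Req_dec c x) as [E|E]; [now right|left]. apply Hpos. split; [apply pow_le; lra|].
  apply Rle_lt_trans with u; [|lra]. rewrite <- Ex. apply pow_incr. lra. }
assert (HP' : 0 < PSeries (deriv_coef nu) (c ^ 4)).
{ destruct HP as [HP| ->]; [easy|]. rewrite Ex. now apply Hpos. }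
assert (0 < x * F u) by nra.
apply Rmult_lt_reg_l with x; lra.
Qed.

(** At the fourth root x of rho, g' vanishes, hence no disc of radius greater than x
    qualifies.  For |z| < x, with s = |z|^4, Re(z g'/g) >= 1 + 4 s F'(s)/F(s) = G(s)/F(s) > 0. *)
Lemma r_star_first_zero (nu rho : R) (g : C -> C) : -1 < nu -> is_g_nu nu g ->
  0 < rho -> PSeries (deriv_coef nu) rho = 0 ->
  (forall u, 0 <= u < rho -> 0 < PSeries (deriv_coef nu) u) ->
  r_star g = Finite (nth_root 4 rho).
Proof.
intros Hnu Hg Hr Hz Hpos.
assert (Hlp := laguerre_polya_bessel_product nu Hnu).
assert (Hgz := is_g_nu_unique nu g Hnu Hg).
assert (Hgd := fun z => C_derive_normalized_cross nu g z Hnu Hgz).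
set (x := nth_root 4 rho).
assert (Hx : 0 < x) by apply exp_pos.
assert (Ex : x ^ 4 = rho).
{ unfold x, nth_root. rewrite <- Rpower_pow, Rpower_mult by apply exp_pos.
  replace (1 / INR 4 * INR 4) with 1 by (simpl; field). now apply Rpower_1. }
apply is_lub_Rbar_unique. split.
- intros r [Hr0 Hs]. apply Rnot_lt_le. intro Hlt.
  destruct (Hs (RtoC x)) as [_ Hre].
  + intro E. apply RtoC_inj in E. lra.
  + rewrite Cmod_R, Rabs_pos_eq; lra.
  + rewrite Hgd, <- !RtoC_mult, !cseries_RtoC, <- RtoC_mult, <- RtoC_plus in Hre.
    replace (x * x * (x * x)) with rho in Hre by (rewrite <- Ex; ring).
    rewrite <- PSeries_deriv_coef, Hz in Hre by easy.
    replace (RtoC x * RtoC 0 / g (RtoC x))%C with (RtoC 0) in Hre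
      by (unfold Cdiv; rewrite <- Cmult_assoc; ring).
    simpl in Hre. lra.
- intros b Hb. apply Hb. split; [easy|]. intros z Hz0 Hzx.
  set (t := (z * z * (z * z))%C). set (s := Cmod t).
  assert (Es : s = Cmod z ^ 4) by (unfold s, t; rewrite !Cmod_mult; ring).
  assert (Hs : 0 <= s < rho).
  { split; [apply Cmod_ge_0|]. rewrite Es, <- Ex.
    assert (H0 := Cmod_ge_0 z). apply Rminus_gt_0_lt.
    replace (x ^ 4 - Cmod z ^ 4)
      with ((x - Cmod z) * (x + Cmod z) * (x ^ 2 + Cmod z ^ 2)) by ring.
    assert (0 < x ^ 2) by now apply pow_lt. assert (0 <= Cmod z ^ 2) by now apply pow_le.
    repeat apply Rmult_lt_0_compat; lra. }
  destruct (Re_log_derivative_ge (bessel_product_coef nu) t Hlp) as [Hne Hge].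
  { intros u Hu. apply (bessel_product_pos nu rho Hnu Hpos). fold s in Hu. lra. }
  fold s in Hge.
  assert (Hgne : g z <> RtoC 0).
  { rewrite Hgz. now apply Cmult_neq_0. }
  split; [exact Hgne|].
  rewrite Hgd. fold t.
  set (Ft := cseries (bessel_product_coef nu) t) in *.
  set (Tt := cseries (fun n => INR n * bessel_product_coef nu n) t) in *.
  replace (z * (Ft + 4 * Tt) / g z)%C with (1 + 4 * (Tt / Ft))%C.
  2:{ rewrite Hgz. unfold normalized_cross. fold t. fold Ft. field. now split. }
  assert (Hp1 := bessel_product_pos nu rho Hnu Hpos s Hs).
  assert (Hp2 := Hpos s Hs). rewrite PSeries_deriv_coef in Hp2 by easy.
  set (Fs := PSeries (bessel_product_coef nu) s) in *.
  set (Ts := PSeries (fun n => INR n * bessel_product_coef nu n) s) in *.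
  replace (Re (1 + 4 * (Tt / Ft))) with (1 + 4 * Re (Tt / Ft)).
  2:{ destruct (Tt / Ft)%C. simpl. ring. }
  assert (0 < (Fs + 4 * Ts) / Fs) by now apply Rdiv_lt_0_compat.
  replace ((Fs + 4 * Ts) / Fs) with (1 + 4 * (Ts / Fs)) in * by (field; lra). lra.
Qed.

Lemma nth_root_lt (n : nat) (a b : R) : (0 < n)%nat -> 0 < a < b -> nth_root n a < nth_root n b.
Proof.
intros Hn Hab. apply Rlt_Rpower_l; [|easy].
apply Rdiv_lt_0_compat; [lra|now apply lt_0_INR].
Qed.

Lemma nth_root_pow (n k : nat) (a : R) : (0 < n)%nat -> (0 < k)%nat -> 0 < a ->
  nth_root (n * k) (a ^ k) = nth_root n a.
Proof.
intros Hn Hk Ha. unfold nth_root. rewrite <- Rpower_pow, Rpower_mult by easy. f_equal.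
rewrite mult_INR. field. split; apply not_0_INR; lia.
Qed.

Theorem theorem7 (nu : R) (g : C -> C) (hnu : -1 < nu) (hg : is_g_nu nu g) :
  Rbar_lt (r_star g) (Finite (nth_root 4 (4 * poch (nu + 1) 3)))
  /\
  (Rbar_lt (Finite (nth_root 4 (16 * poch (nu + 1) 3 / 5))) (r_star g)
   /\
   Rbar_lt (r_star g)
     (Finite (nth_root 4 (80 * poch (nu + 1) 5 / (16 * nu ^ 2 + 189 * nu + 473)))))
  /\
  (Rbar_lt
     (Finite (nth_root 8 (2 ^ 8 * poch (nu + 1) 3 * poch (nu + 1) 5
                          / (16 * nu ^ 2 + 189 * nu + 473))))
     (r_star g)
   /\
   Rbar_lt (r_star g)
     (Finite (nth_root 4 (8 * poch (nu + 1) 3 * (nu + 6) * (nu + 7)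
                          * (16 * nu ^ 2 + 189 * nu + 473) / nu_3 nu))))
  /\
  (Rbar_lt
     (Finite (nth_root 12 (2 ^ 11 * (poch (nu + 1) 3) ^ 2 * poch (nu + 1) 7
                           / nu_3 nu)))
     (r_star g)
   /\
   Rbar_lt (r_star g)
     (Finite (nth_root 4 (32 * poch (nu + 1) 5 * (nu + 8) * (nu + 9) * nu_3 nu
                          / nu_4 nu)))).
Proof.
assert (Q := nu_2_pos nu hnu). assert (N3 := nu_3_pos nu hnu). assert (N4 := nu_4_pos nu hnu).
assert (P3 := poch_pos (nu + 1) 3 ltac:(lra)). assert (P5 := poch_pos (nu + 1) 5 ltac:(lra)).
assert (P7 := poch_pos (nu + 1) 7 ltac:(lra)). assert (P9 := poch_pos (nu + 1) 9 ltac:(lra)).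
assert (E7 : poch (nu + 1) 7 = poch (nu + 1) 5 * (nu + 6) * (nu + 7)) by (simpl; ring).
assert (E9 : poch (nu + 1) 9 = poch (nu + 1) 7 * (nu + 8) * (nu + 9)) by (simpl; ring).
destruct (newton_deriv_coef nu hnu) as [S1 [S2 [S3 S4]]].
destruct (newton_deriv_coef_strict nu hnu) as [H22 H33].
assert (Hlp := laguerre_polya_deriv_coef nu hnu).
change (16 * nu ^ 2 + 189 * nu + 473) with (nu_2 nu).
remember (poch (nu + 1) 3) as p3. remember (poch (nu + 1) 5) as p5.
remember (poch (nu + 1) 7) as p7. remember (poch (nu + 1) 9) as p9.
assert (A1 : 0 < newton1 (deriv_coef nu)) by (rewrite S1; apply Rdiv_lt_0_compat; lra).
assert (A2 : 0 < newton2 (deriv_coef nu)).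
{ rewrite S2. apply Rdiv_lt_0_compat; [easy|].
  repeat apply Rmult_lt_0_compat; try apply pow_lt; lra. }
assert (A3 : 0 < newton3 (deriv_coef nu)).
{ rewrite S3. apply Rdiv_lt_0_compat; [easy|].
  repeat apply Rmult_lt_0_compat; try apply pow_lt; lra. }
assert (A4 : 0 < newton4 (deriv_coef nu)).
{ rewrite S4. apply Rdiv_lt_0_compat; [easy|].
  repeat apply Rmult_lt_0_compat; try apply pow_lt; lra. }
destruct (first_zero (deriv_coef nu) Hlp A2) as [rho [Hr [Hz Hpos]]].
rewrite (r_star_first_zero nu rho g hnu hg Hr Hz Hpos).
destruct (euler_rayleigh (deriv_coef nu) rho Hlp Hr Hz Hpos A1 A2 A3 A4 H22 H33)
  as [U1 [U2 [U3 [L1 [L2 L3]]]]].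
replace (newton1 (deriv_coef nu) / newton2 (deriv_coef nu)) with (80 * p5 / nu_2 nu) in U1
  by (rewrite S1, S2; field; lra).
replace (newton2 (deriv_coef nu) / newton3 (deriv_coef nu))
  with (8 * p3 * (nu + 6) * (nu + 7) * nu_2 nu / nu_3 nu) in U2
  by (rewrite S2, S3, E7; field; lra).
replace (newton3 (deriv_coef nu) / newton4 (deriv_coef nu))
  with (32 * p5 * (nu + 8) * (nu + 9) * nu_3 nu / nu_4 nu) in U3
  by (rewrite S3, S4, E9; field; lra).
(* 4 (nu+1)_3 exceeds the bound sigma_2 / sigma_3. *)
assert (U0 : rho < 4 * p3).
{ apply Rlt_trans with (1 := U2). apply Rmult_lt_reg_r with (nu_3 nu); [easy|].
  replace (8 * p3 * (nu + 6) * (nu + 7) * nu_2 nu / nu_3 nu * nu_3 nu)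
    with (4 * p3 * (2 * (nu + 6) * (nu + 7) * nu_2 nu)) by (field; lra).
  apply Rmult_lt_compat_l; [lra|]. apply Rminus_gt_0_lt.
  replace (nu_3 nu - 2 * (nu + 6) * (nu + 7) * nu_2 nu) with
    (30 * (nu + 1) ^ 3 + 675 * (nu + 1) ^ 2 + 3330 * (nu + 1) + 4500)
    by (unfold nu_3, nu_2; ring).
  repeat apply Rplus_lt_0_compat; try apply Rmult_lt_0_compat; try apply pow_lt; lra. }
assert (inv_lt : forall a r, 0 < a -> 1 < a * r -> / a < r).
{ intros a r Ha H. apply Rmult_lt_reg_l with a; [easy|]. rewrite Rinv_r; lra. }
apply inv_lt in L1; [|easy]. apply inv_lt in L2; [|easy]. apply inv_lt in L3; [|easy].
replace (/ newton1 (deriv_coef nu)) with (16 * p3 / 5) in L1 by (rewrite S1; field; lra).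
replace (/ newton2 (deriv_coef nu)) with (2 ^ 8 * p3 * p5 / nu_2 nu) in L2
  by (rewrite S2; field; lra).
replace (/ newton3 (deriv_coef nu)) with (2 ^ 11 * p3 ^ 2 * p7 / nu_3 nu) in L3
  by (rewrite S3; field; lra).
split; [|split; [split|split; [split|split]]]; simpl Rbar_lt.
- apply nth_root_lt; [lia|lra].
- apply nth_root_lt; [lia|]. split; [apply Rdiv_lt_0_compat; lra|exact L1].
- apply nth_root_lt; [lia|lra].
- rewrite <- (nth_root_pow 4 2 rho) by (lia || easy). apply nth_root_lt; [lia|].
  split; [|exact L2]. apply Rdiv_lt_0_compat; [|easy].
  repeat apply Rmult_lt_0_compat; try apply pow_lt; lra.
- apply nth_root_lt; [lia|lra].
- rewrite <- (nth_root_pow 4 3 rho) by (lia || easy). apply nth_root_lt; [lia|].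
  split; [|exact L3]. apply Rdiv_lt_0_compat; [|easy].
  repeat apply Rmult_lt_0_compat; try apply pow_lt; lra.
- apply nth_root_lt; [lia|lra].
Qed.
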